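(* Let $G$ be a nontrivial small finite subgroup of $\mathrm{GL}(2,\mathbb{C})$, let $X=\mathbb{A}^2/G$, and let $\varphi:X\to X$ be a quasi-étale endomorphism. Suppose that $\varphi$ preserves the standard $\mathbb{A}^1_\ast$-fibration $p^\circ:X^\circ\to C$, namely that there exists an endomorphism $\beta:C\to C$ such that $p^\circ\circ(\varphi|_{X^\circ})=\beta\circ p^\circ$. Then $\varphi$ is an automorphism.
   Context: All varieties are over $\mathbb{C}$. A finite subgroup of $\mathrm{GL}(2,\mathbb{C})$ is small if it contains no pseudo-reflection (no element $g\ne1$ fixing a line of $\mathbb{C}^2$ pointwise). $X=\mathbb{A}^2/G$ has a unique singular point $P_0$, the image of the origin $O$; $X^\circ=X\setminus\{P_0\}$. An endomorphism $\varphi:X\to X$ is quasi-étale if it restricts to an étale endomorphism $X^\circ\to X^\circ$. $\mathbb{A}^1_\ast$ is the affine line minus one point. The standard $\mathbb{A}^1_\ast$-fibration $p^\circ:X^\circ\to C$, $C\cong\mathbb{P}^1$, is the one determined by the $G_m$-action on $X$ inherited from the scaling action ${}^t(x,y)=(tx,ty)$ on $\mathbb{A}^2$ (which commutes with the linear $G$-action): it is the morphism induced by $\mathbb{A}^2\setminus\{O\}\to\mathbb{P}^1$, $(x,y)\mapsto[x:y]$, on quotients by $G$, with $C=\mathbb{P}^1/G$. *)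

(* Defs.v *)
From HB Require Import structures.
From mathcomp Require Import mpoly.
From mathcomp Require Import all_boot all_order all_algebra generic_quotient.
From mathcomp Require Import all_classical reals topology.
From mathcomp Require Import complex.

Set Implicit Arguments.
Unset Strict Implicit.
Unset Printing Implicit Defensive.

Import GRing.Theory.
Local Open Scope classical_set_scope.
Local Open Scope ring_scope.
Local Open Scope quotient_scope.

(** Varieties are treated as spaces with functions: a topological space with a
    sheaf of [K]-valued functions. [regular_at x f] says that the function [f],
    of which only the germ at [x] matters, is regular in some neighbourhood of
    [x]; the sections of the sheaf over an open set [U] are the functions that
    are regular at every point of [U]. *)
Record funspace (K : fieldType) := FunSpace {
  points :> topologicalType;
  regular_at : points -> (points -> K) -> Prop;
  regular_near : forall x f, regular_at x f -> \forall y \near x, regular_at y f;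
  regular_germ : forall x f g, (\forall y \near x, f y = g y) ->
    regular_at x f -> regular_at x g;
  regular_cst : forall x a, regular_at x (cst a);
  regularD : forall x f g,
    regular_at x f -> regular_at x g -> regular_at x (f \+ g);
  regularM : forall x f g,
    regular_at x f -> regular_at x g -> regular_at x (f \* g);
  regular_neq0 : forall x f, regular_at x f -> f x != 0 ->
    \forall y \near x, f y != 0;
  regularV : forall x f, regular_at x f -> f x != 0 ->
    regular_at x (fun y => (f y)^-1)
}.

Record morphism (K : fieldType) (S T : funspace K) := Morphism {
  mor_fun :> S -> T;
  mor_continuous : continuous mor_fun;
  mor_regular : forall x g,
    regular_at (mor_fun x) g -> regular_at x (g \o mor_fun)
}.

Definition inverse_morphisms (K : fieldType) (S T : funspace K)
    (f : morphism S T) (g : morphism T S) :=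
  cancel f g /\ cancel g f.

Definition isomorphic (K : fieldType) (S T : funspace K) :=
  exists (f : morphism S T) (g : morphism T S), inverse_morphisms f g.

Definition is_automorphism (K : fieldType) (S : funspace K)
    (f : morphism S S) :=
  exists g : morphism S S, inverse_morphisms f g.

Section Sections.
Variables (K : fieldType) (S : funspace K).

Definition global_regular : {pred S -> K} :=
  [pred f | `[< forall x, regular_at x f >]].

Lemma global_regular_subring : subring_closed global_regular.
Proof.
split=> [|f g|f g].
- by apply/asboolP => x; exact: regular_cst.
- move=> /asboolP fr /asboolP gr; apply/asboolP => x.
  apply: regularD; first exact: fr.
  apply: (@regular_germ _ _ _ (cst (-1) \* g)).
    by apply: nearW => y /=; rewrite mulN1r.
  by apply: regularM; [exact: regular_cst|exact: gr].
- move=> /asboolP fr /asboolP gr; apply/asboolP => x.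
  by apply: regularM; [exact: fr|exact: gr].
Qed.

Record sections := GlobalSection {
  section_fun :> S -> K;
  section_regular : section_fun \in global_regular
}.

HB.instance Definition _ := [isSub for section_fun].
HB.instance Definition _ := [Choice of sections by <:].
HB.instance Definition _ := GRing.SubChoice_isSubComPzRing.Build
  (S -> K) global_regular sections global_regular_subring.

End Sections.

Section Pullback.
Variables (K : fieldType) (S T : funspace K) (f : morphism S T).

Lemma pullback_subproof (a : sections T) :
  section_fun a \o f \in @global_regular K S.
Proof.
apply/asboolP => x; apply: mor_regular.
by have /asboolP := section_regular a; exact.
Qed.

Definition pullback (a : sections T) : sections S :=
  GlobalSection (pullback_subproof a).

Lemma pullback_is_zmod_morphism : zmod_morphism pullback.
Proof. by move=> a b; apply: val_inj. Qed.

Lemma pullback_is_monoid_morphism : monoid_morphism pullback.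
Proof. by split=> [|a b]; apply: val_inj. Qed.

HB.instance Definition _ := GRing.isZmodMorphism.Build
  (sections T) (sections S) pullback pullback_is_zmod_morphism.
HB.instance Definition _ := GRing.isMonoidMorphism.Build
  (sections T) (sections S) pullback pullback_is_monoid_morphism.

End Pullback.

Section Subspace.
Variables (K : fieldType) (S : funspace K) (Z : set S).

Let regat (z : set_type Z) (f : set_type Z -> K) :=
  exists2 F : S -> K, regular_at (val z) F & \forall w \near z, f w = F (val w).

Let val_near (z : set_type Z) (P : S -> Prop) :
  (\forall y \near val z, P y) -> \forall w \near z, P (val w).
Proof.
by move=> Pz; exact: (@initial_continuous _ _ (@set_val _ Z) z P Pz).
Qed.

Let regat_near z f : regat z f -> \forall w \near z, regat w f.
Proof.
move=> [F /regular_near/val_near Fr /near_join fF].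
by apply: filterS2 Fr fF => w Fr fF; exists F.
Qed.

Let regat_germ z f g : (\forall w \near z, f w = g w) -> regat z f -> regat z g.
Proof.
move=> fg [F Fr fF]; exists F => //.
by apply: filterS2 fg fF => w ->.
Qed.

Let regat_cst z a : regat z (cst a).
Proof.
by exists (cst a); [exact: regular_cst|exact: (@filterE _ (nbhs z))].
Qed.

Let regatD z f g : regat z f -> regat z g -> regat z (f \+ g).
Proof.
move=> [F Fr fF] [G Gr gG]; exists (F \+ G); first exact: regularD.
by apply: filterS2 fF gG => w /= -> ->.
Qed.

Let regatM z f g : regat z f -> regat z g -> regat z (f \* g).
Proof.
move=> [F Fr fF] [G Gr gG]; exists (F \* G); first exact: regularM.
by apply: filterS2 fF gG => w /= -> ->.
Qed.

Let regat_neq0 z f : regat z f -> f z != 0 -> \forall w \near z, f w != 0.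
Proof.
move=> [F Fr fF]; rewrite (nbhs_singleton fF) => /(regular_neq0 Fr)/val_near F0.
by apply: filterS2 fF F0 => w ->.
Qed.

Let regatV z f : regat z f -> f z != 0 -> regat z (fun w => (f w)^-1).
Proof.
move=> [F Fr fF]; rewrite (nbhs_singleton fF) => F0.
exists (fun y => (F y)^-1); first exact: regularV.
by apply: filterS fF => w ->.
Qed.

(** On an open subset this is the restriction of the sheaf; on a closed subset
    of an affine space, the structure of (reduced) closed subvariety. *)
Definition subfunspace : funspace K :=
  FunSpace regat_near regat_germ regat_cst regatD regatM regat_neq0 regatV.

End Subspace.

Section Quotient.
Variables (K : fieldType) (S : funspace K) (e : equiv_rel S).

Let Q := quotient_topology {eq_quot e}.

Let regat (q : Q) (f : Q -> K) :=
  \forall q' \near q, forall x : S, \pi_Q x = q' ->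
    regular_at x (f \o \pi_Q).

Let pi_near (x : S) (P : Q -> Prop) :
  (\forall q \near \pi_Q x, P q) -> \forall y \near x, P (\pi_Q y).
Proof. by move=> Pq; exact: (@pi_continuous _ _ x P Pq). Qed.

Let regat_near q f : regat q f -> \forall q' \near q, regat q' f.
Proof. by move=> /near_join. Qed.

Let regat_germ q f g : (\forall q' \near q, f q' = g q') -> regat q f -> regat q g.
Proof.
move=> /near_join fg fr; apply: filterS2 fg fr => q' fg fr x xq'.
apply: regular_germ (fr x xq').
by apply: (@pi_near x (fun q => f q = g q)); rewrite xq'.
Qed.

Let regat_cst q a : regat q (cst a).
Proof.
by apply: (@nearW _ (nbhs q)) => q' x _; exact: (@regular_cst _ S x a).
Qed.

Let regatD q f g : regat q f -> regat q g -> regat q (f \+ g).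
Proof.
by move=> fr gr; apply: filterS2 fr gr => q' fr gr x xq';
  apply: (@regularD _ S x (f \o \pi_Q) (g \o \pi_Q)); [exact: fr|exact: gr].
Qed.

Let regatM q f g : regat q f -> regat q g -> regat q (f \* g).
Proof.
by move=> fr gr; apply: filterS2 fr gr => q' fr gr x xq';
  apply: (@regularM _ S x (f \o \pi_Q) (g \o \pi_Q)); [exact: fr|exact: gr].
Qed.

Let regat_neq0 q f : regat q f -> f q != 0 -> \forall q' \near q, f q' != 0.
Proof.
set A := [set q' | forall x : S, \pi_Q x = q' -> regular_at x (f \o \pi_Q)].
move=> fr fq0; pose U := interior A.
have oU : open U := open_interior A.
have Ur : U `<=` A := @interior_subset _ A.
suff Vq : open_nbhs q (U `&` [set q' | f q' != 0]).
  by apply: filterS (open_nbhs_nbhs Vq) => q' [].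
split=> //; rewrite /open/= /quotient_open openE => x /= [Ux fx0].
have Unear : \forall y \near x, U (\pi_Q y).
  by apply: (@pi_near x U); apply: open_nbhs_nbhs.
apply: filterI; first exact: Unear.
exact: (@regular_neq0 _ S x (f \o \pi_Q) (Ur _ Ux _ erefl) fx0).
Qed.

Let regatV q f : regat q f -> f q != 0 -> regat q (fun q' => (f q')^-1).
Proof.
move=> fr fq0; apply: filterS2 fr (regat_neq0 fr fq0) => q' fr fq'0 x xq'.
apply: (@regularV _ S x (f \o \pi_Q)); first exact: fr.
by rewrite /= xq'.
Qed.

(** A function on the quotient is regular when its pullback is; for a finite
    group of automorphisms, its regular functions are the invariant ones. *)
Definition quotient_funspace : funspace K :=
  FunSpace regat_near regat_germ regat_cst regatD regatM regat_neq0 regatV.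

Definition quotient_pi (x : S) : quotient_funspace := \pi_Q x.
Definition quotient_repr (q : quotient_funspace) : S := repr (q : Q).

Lemma quotient_reprK : cancel quotient_repr quotient_pi.
Proof. by move=> q; rewrite /quotient_pi /quotient_repr reprK. Qed.

Lemma quotient_piP (x y : S) : quotient_pi x = quotient_pi y <-> e x y.
Proof. by split=> [/eqmodP|exy]; last apply/eqmodP. Qed.

End Quotient.

Definition zariski (K : fieldType) (n : nat) : Type := 'cV[K]_n.

Section AffineSpace.
Variables (K : fieldType) (n : nat).
Local Notation A := (zariski K n).
Local Notation poly := {mpoly K[n]}.

HB.instance Definition _ := Choice.copy A 'cV[K]_n.

Definition evalp (p : poly) (x : A) : K := p.@[fun i => x i ord0].

Definition zero_locus (E : set poly) : set A :=
  [set x | forall p, E p -> evalp p x = 0].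

Definition zariski_open (U : set A) := exists E, U = ~` zero_locus E.

Lemma zariski_openP (U : set A) : zariski_open U <->
  forall x, U x -> exists2 p, evalp p x != 0 & forall y, evalp p y != 0 -> U y.
Proof.
split=> [[E ->] x|Up].
  move=> /existsNP[p /not_implyP[Ep /eqP px]]; exists p => // y /eqP py yE.
  exact/py/yE.
exists [set p | forall y, evalp p y != 0 -> U y].
apply/seteqP; split=> x /=.
  by move=> /Up[p px pU] /(_ p pU) /eqP; exact/negP.
by move=> /existsNP[p /not_implyP[pU /eqP px]]; exact: pU.
Qed.

Lemma zariski_openT : zariski_open setT.
Proof.
apply/zariski_openP => x _; exists 1 => //.
by rewrite /evalp meval1 oner_eq0.
Qed.

Lemma zariski_openI : setI_closed zariski_open.
Proof.
move=> U V /zariski_openP oU /zariski_openP oV; apply/zariski_openP.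
move=> x [/oU[p px pU] /oV[q qx qV]]; exists (p * q).
  by rewrite /evalp mevalM mulf_neq0.
move=> y; rewrite /evalp mevalM mulf_eq0 negb_or => /andP[py qy].
by split; [exact: pU|exact: qV].
Qed.

Lemma zariski_open_bigU (I : Type) (F : I -> set A) :
  (forall i, zariski_open (F i)) -> zariski_open (\bigcup_i F i).
Proof.
move=> oF; apply/zariski_openP => x [i _ Fix].
have /zariski_openP/(_ x Fix)[p px pF] := oF i; exists p => // y py.
by exists i => //; exact: pF.
Qed.

HB.instance Definition _ := isOpenTopological.Build A
  zariski_openT zariski_openI zariski_open_bigU.

Let regat (x : A) (f : A -> K) :=
  exists p q : poly, evalp q x != 0 /\
    \forall y \near x, f y = evalp p y / evalp q y.

Let evalp_neq0 (q : poly) (x : A) :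
  evalp q x != 0 -> \forall y \near x, evalp q y != 0.
Proof.
move=> qx; apply: (@open_nbhs_nbhs _ x [set y | evalp q y != 0]); split=> //.
by apply/zariski_openP => y qy; exists q.
Qed.

Let regat_near x f : regat x f -> \forall y \near x, regat y f.
Proof.
move=> [p [q [/evalp_neq0 q0 /near_join fpq]]].
by apply: filterS2 q0 fpq => y qy fpq; exists p, q.
Qed.

Let regat_germ x f g : (\forall y \near x, f y = g y) -> regat x f -> regat x g.
Proof.
move=> fg [p [q [qx fpq]]]; exists p, q; split=> //.
by apply: filterS2 fg fpq => y ->.
Qed.

Let regat_cst x a : regat x (cst a).
Proof.
exists (a%:MP_[n]), 1; rewrite /evalp meval1 oner_neq0; split=> //.
by apply: (@nearW _ (nbhs x)) => y; rewrite mevalC meval1 divr1.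
Qed.

Let regatD x f g : regat x f -> regat x g -> regat x (f \+ g).
Proof.
move=> [p [q [qx fpq]]] [r [s [sx grs]]]; exists (p * s + r * q), (q * s).
split; first by rewrite /evalp mevalM mulf_neq0.
near=> y; have qy : evalp q y != 0 by near: y; exact: evalp_neq0.
have sy : evalp s y != 0 by near: y; exact: evalp_neq0.
have /= -> : f y = evalp p y / evalp q y by near: y.
have -> : g y = evalp r y / evalp s y by near: y.
by rewrite /evalp mevalD !mevalM addf_div.
Unshelve. all: by end_near. Qed.

Let regatM x f g : regat x f -> regat x g -> regat x (f \* g).
Proof.
move=> [p [q [qx fpq]]] [r [s [sx grs]]]; exists (p * r), (q * s).
split; first by rewrite /evalp mevalM mulf_neq0.
apply: filterS2 fpq grs => y /= -> ->.
by rewrite /evalp !mevalM mulf_div.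
Qed.

Let regat_neq0 x f : regat x f -> f x != 0 -> \forall y \near x, f y != 0.
Proof.
move=> [p [q [qx fpq]]]; rewrite (nbhs_singleton fpq) => pq0.
have px : evalp p x != 0 by apply: contraNneq pq0 => ->; rewrite mul0r.
near=> y; have -> : f y = evalp p y / evalp q y by near: y.
by rewrite mulf_neq0 ?invr_eq0//; near: y; exact: evalp_neq0.
Unshelve. all: by end_near. Qed.

Let regatV x f : regat x f -> f x != 0 -> regat x (fun y => (f y)^-1).
Proof.
move=> [p [q [qx fpq]]]; rewrite (nbhs_singleton fpq) => pq0.
exists q, p; split; first by apply: contraNneq pq0 => ->; rewrite mul0r.
by apply: filterS fpq => y ->; rewrite invf_div.
Qed.

Definition affine_space : funspace K :=
  FunSpace regat_near regat_germ regat_cst regatD regatM regat_neq0 regatV.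

End AffineSpace.

Definition is_affine (K : fieldType) (S : funspace K) :=
  exists (n : nat) (Z : set (affine_space K n)),
    closed Z /\ isomorphic S (subfunspace Z).

(** The infinitesimal lifting property, over arbitrary square-zero extensions
    [T -> T0]. *)
Definition formally_etale (A B : comPzRingType) (f : {rmorphism A -> B}) :=
  forall (T T0 : comPzRingType) (p : {rmorphism T -> T0})
    (u : {rmorphism A -> T}) (v : {rmorphism B -> T0}),
    (forall y, exists x, p x = y) ->
    (forall x y, p x = 0 -> p y = 0 -> x * y = 0) ->
    (forall a, v (f a) = p (u a)) ->
    exists w : {rmorphism B -> T},
      [/\ forall a, w (f a) = u a,
          forall b, p (w b) = v b
        & forall w' : {rmorphism B -> T}, (forall a, w' (f a) = u a) ->
            (forall b, p (w' b) = v b) -> w' =1 w].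

(** The coordinate rings of affine varieties are finitely generated algebras
    over a field, so the ring maps below are of finite presentation, and étale
    is the same as formally étale. *)
Definition etale (K : fieldType) (S T : funspace K) (f : morphism S T) :=
  forall x : S, exists (U : set S) (V : set T)
    (g : morphism (subfunspace U) (subfunspace V)),
    [/\ open U, U x, open V & V (f x)] /\
    [/\ is_affine (subfunspace U), is_affine (subfunspace V),
        forall u, val (g u) = f (val u) & formally_etale (pullback g)].

Record finite_subgroup_GL2 (K : fieldType) := FiniteSubgroupGL2 {
  gl2_set :> 'M[K]_2 -> Prop;
  gl2_finite : finite_set gl2_set;
  gl2_unit : forall g, gl2_set g -> g \in unitmx;
  gl2_1 : gl2_set 1%:M;
  gl2_mul : forall g h, gl2_set g -> gl2_set h -> gl2_set (g *m h);
  gl2_inv : forall g, gl2_set g -> gl2_set (invmx g)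
}.

(** Only lines through the origin need to be considered: a linear map fixing any
    other line pointwise is the identity. *)
Definition pseudo_reflection (K : fieldType) (g : 'M[K]_2) :=
  g <> 1%:M /\
  exists2 v : 'cV[K]_2, v != 0 & forall a : K, g *m (a *: v) = a *: v.

Definition small (K : fieldType) (G : finite_subgroup_GL2 K) :=
  forall g, G g -> ~ pseudo_reflection g.

Section Main.
Variables (K : fieldType) (G : finite_subgroup_GL2 K).

Local Notation A2 := (affine_space K 2).

(** The quotient surface [quotA2] = A²/G, its distinguished point [P0] and its
    open complement [quotA2o]. *)
Definition orbit_rel (x y : A2) : bool :=
  `[< exists2 g, G g & (y : 'cV[K]_2) = g *m x >].

Lemma orbit_refl : reflexive orbit_rel.
Proof. by move=> x; apply/asboolP; exists 1%:M; [exact: gl2_1|rewrite mul1mx]. Qed.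

Lemma orbit_sym : symmetric orbit_rel.
Proof.
have S x y : orbit_rel x y -> orbit_rel y x.
  move=> /asboolP[g Gg ->]; apply/asboolP; exists (invmx g); first exact: gl2_inv.
  by rewrite mulKmx// (gl2_unit Gg).
by move=> x y; apply/idP/idP; exact: S.
Qed.

Lemma orbit_trans : transitive orbit_rel.
Proof.
move=> y x z /asboolP[g Gg ->] /asboolP[h Gh ->]; apply/asboolP.
by exists (h *m g); [exact: gl2_mul|rewrite mulmxA].
Qed.

Definition orbit_equiv := EquivRel orbit_rel orbit_refl orbit_sym orbit_trans.

Definition quotA2 : funspace K := quotient_funspace orbit_equiv.

Definition P0 : quotA2 := quotient_pi orbit_equiv (0 : 'cV[K]_2).

Definition quotA2o : funspace K := subfunspace (~` [set P0]).

(** [quotP1] = P¹/G, where P¹ is the quotient of A² minus the origin by scaling. *)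
Definition A2o : funspace K := subfunspace (~` [set (0 : 'cV[K]_2) : A2]).

Definition vec (v : A2o) : 'cV[K]_2 := val v.

Lemma vec_neq0 (v : A2o) : vec v != 0.
Proof. by apply/eqP; have := valP v; rewrite inE. Qed.

Definition mkA2o (v : 'cV[K]_2) (v0 : v != 0) : A2o :=
  SigSub (mem_set (elimN eqP v0 : (~` [set (0 : 'cV[K]_2) : A2]) v)).

Definition line_rel (v w : A2o) : bool :=
  `[< exists2 t : K, t != 0 & vec w = t *: vec v >].

Lemma line_refl : reflexive line_rel.
Proof. by move=> v; apply/asboolP; exists 1; rewrite ?oner_neq0 ?scale1r. Qed.

Lemma line_sym : symmetric line_rel.
Proof.
have S v w : line_rel v w -> line_rel w v.
  move=> /asboolP[t t0 wv]; apply/asboolP; exists t^-1; first by rewrite invr_eq0.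
  by rewrite wv scalerA mulVf// scale1r.
by move=> v w; apply/idP/idP; exact: S.
Qed.

Lemma line_trans : transitive line_rel.
Proof.
move=> w v z /asboolP[t t0 wv] /asboolP[s s0 zw]; apply/asboolP.
by exists (s * t); [rewrite mulf_neq0|rewrite zw wv scalerA].
Qed.

Definition line_equiv := EquivRel line_rel line_refl line_sym line_trans.

Definition P1 : funspace K := quotient_funspace line_equiv.

Definition line_of : A2o -> P1 := quotient_pi line_equiv.

Definition P1_rel (p q : P1) : bool :=
  `[< exists g v w, [/\ G g, vec w = g *m vec v, p = line_of v & q = line_of w] >].

Lemma P1_refl : reflexive P1_rel.
Proof.
move=> p; apply/asboolP; exists 1%:M, (quotient_repr p), (quotient_repr p).
by rewrite mul1mx /line_of quotient_reprK; split=> //; exact: gl2_1.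
Qed.

Lemma P1_sym : symmetric P1_rel.
Proof.
have S p q : P1_rel p q -> P1_rel q p.
  move=> /asboolP[g [v [w [Gg wv pv qw]]]]; apply/asboolP; exists (invmx g), w, v.
  by split=> //; [exact: gl2_inv|rewrite wv mulKmx// (gl2_unit Gg)].
by move=> p q; apply/idP/idP; exact: S.
Qed.

Lemma P1_trans : transitive P1_rel.
Proof.
move=> q p r /asboolP[g [v [w [Gg wv -> qw]]]] /asboolP[h [v' [w' [Gh wv' qv' ->]]]].
have /quotient_piP/asboolP[t t0 v'w] : line_of w = line_of v' by rewrite -qw qv'.
have t'v : t *: vec v != 0 by rewrite scaler_eq0 negb_or t0 vec_neq0.
apply/asboolP; exists (h *m g), (mkA2o t'v), w'; split=> //.
- exact: gl2_mul.
- by rewrite wv' v'w wv /vec/= -!scalemxAr mulmxA.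
- by apply/quotient_piP/asboolP; exists t.
Qed.

Definition P1_equiv := EquivRel P1_rel P1_refl P1_sym P1_trans.

Definition quotP1 : funspace K := quotient_funspace P1_equiv.

Definition line_class (v : A2o) : quotP1 := quotient_pi P1_equiv (line_of v).

Lemma quotA2o_repr_neq0 (x : quotA2o) :
  (quotient_repr (val x) : 'cV[K]_2) != 0.
Proof.
apply/eqP => x0; have := valP x; rewrite inE; apply.
by apply: etrans (esym (quotient_reprK _)) _; rewrite x0.
Qed.

(** The map induced on quotients by [v |-> line_of v]; by [fibrationE] it does
    not depend on the representative. *)
Definition fibration (x : quotA2o) : quotP1 :=
  line_class (mkA2o (quotA2o_repr_neq0 x)).

Lemma fibrationE (v : A2o) (x : quotA2o) :
  val x = quotient_pi orbit_equiv (val v) -> fibration x = line_class v.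
Proof.
move=> xv; apply/quotient_piP/asboolP.
have /quotient_piP/asboolP[g Gg vx] :
  quotient_pi orbit_equiv (quotient_repr (val x)) =
  quotient_pi orbit_equiv (val v) by rewrite quotient_reprK.
by exists g, (mkA2o (quotA2o_repr_neq0 x)), v.
Qed.

Definition restricts_to (phi : morphism quotA2 quotA2)
    (phio : morphism quotA2o quotA2o) :=
  forall x, val (phio x) = phi (val x).

Definition quasi_etale (phi : morphism quotA2 quotA2) :=
  exists2 phio, restricts_to phi phio & etale phio.

Definition preserves_fibration (phi : morphism quotA2 quotA2) :=
  exists2 phio, restricts_to phi phio &
    exists beta : morphism quotP1 quotP1,
      forall x, fibration (phio x) = beta (fibration x).

End Main.

(* Main.v *)
Require Import Defs.
From HB Require Import structures.
From mathcomp Require Import mpoly.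
From mathcomp Require Import all_boot all_order all_algebra generic_quotient.
From mathcomp Require Import all_classical reals topology complex.
From mathcomp Require Import qpoly ring.

Set Implicit Arguments.
Unset Strict Implicit.
Unset Printing Implicit Defensive.

Import Order.TTheory GRing.Theory Num.Theory.
Local Open Scope classical_set_scope.
Local Open Scope ring_scope.
Local Open Scope quotient_scope.

(** Write [pi : A^2 -> X] for the quotient map and identify [O(X)] with the ring
    of [G]-invariant polynomials. The endomorphism [phi] induces a ring
    endomorphism [phi^*] of the invariants ([phis]), because a function regular
    on the whole plane is a polynomial ([regular_plane_poly]).

    Since [phi] maps orbits of scalars to orbits of scalars, an invariant form
    pulls back, along each line through the origin, to zero or to a polynomial
    in one variable [t] without zeros for [t <> 0], hence to a monomial. So [phi^*]
    maps forms to forms ([phis_hom]), and it multiplies all degrees by one and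
    the same ratio ([phis_hom_ratio]).

    The ratio is [1] because [phi] is etale. With [N] the order of [G], the form
    [(dx /\ dy)^N] descends to a nowhere vanishing section of the [N]-th power
    of the canonical bundle of the punctured quotient. Its pullback by an etale
    map is again nowhere vanishing, hence is the section itself times a function
    [c] without zeros or poles on the punctured plane. As [c] is a quotient of
    forms, these have the same degree ([hom_degree_eq]), while the degree of [c]
    is [2 * N] times the ratio minus [1]. In coordinates, [c] is the quotient of
    [jac (phi^* f) (phi^* h) ^+ N] by [phi^* (jac f h ^+ N)], whichever
    invariants [f], [h] are used ([jac_phis], [phis_jac_degree]).

    The two facts on tangent spaces behind this are that a point derivation of
    the invariants at a free orbit comes from a unique tangent vector of the
    plane ([derivation_tangent], [tangent_separated]), and that an etale
    morphism kills no tangent vector ([etale_unramified]), by uniqueness of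
    liftings to the dual numbers. Smallness of [G] makes all orbits but the
    origin free.

    Thus [phi^*] preserves degrees. It is injective as [phi] is dominant
    ([image_dense]), so it is bijective on the forms of each degree, which make
    up a finite-dimensional space ([phis_surj]). Finally every character of the
    ring of invariants is the evaluation at a point ([invariants_point], by
    integrality and Reynolds averaging), and invariants separate orbits, so the
    inverse of [phi^*] gives an inverse of [phi], which is continuous and regular
    because open sets and regular functions of [X] are described by invariants
    ([quot_nbhsP], [regular_quotP]). *)

(** * Polynomials in two variables *)

Lemma mpoly_ring_ind (K : comNzRingType) n (P : {mpoly K[n]} -> Prop) :
  (forall c, P c%:MP) -> (forall i, P 'X_i) ->
  (forall p q, P p -> P q -> P (p + q)) ->
  (forall p q, P p -> P q -> P (p * q)) -> forall p, P p.
Proof.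
move=> PC PX PD PM; apply: mpolyind => [|c m p _ _ Pp].
  by rewrite -(mpolyC0 n K); exact: PC.
apply: (PD _ _ _ Pp); rewrite -mul_mpolyC mpolyXE_id; apply: (PM _ _ (PC c)).
apply: big_ind => [|q r|i _]; [exact: (PC 1)|exact: PM|].
by elim: (m i) => [|k IH]; [exact: (PC 1)|rewrite exprS; exact: PM].
Qed.

Section Poly1.
Variable K : numClosedFieldType.
Implicit Types p q : {poly K}.

Lemma poly_fun0 p : (forall t, t != 0 -> p.[t] = 0) -> p = 0.
Proof.
move=> p0; apply/eqP; apply: contraTT isT => pn0.
have := @max_poly_roots _ p [seq (i.+1)%:R | i <- iota 0 (size p)] pn0.
rewrite size_map size_iota ltnn; apply.
  by apply/allP => _ /mapP[i _ ->]; apply/eqP/p0; rewrite pnatr_eq0.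
by rewrite map_inj_uniq ?iota_uniq// => i j /eqP; rewrite eqr_nat eqSS => /eqP.
Qed.

Lemma poly_fun_inj p q : (forall t, t != 0 -> p.[t] = q.[t]) -> p = q.
Proof.
move=> pq; apply/eqP; rewrite -subr_eq0; apply/eqP/poly_fun0 => t t0.
by rewrite hornerD hornerN pq// subrr.
Qed.

End Poly1.

Section Plane.
Variable K : numClosedFieldType.
Local Notation S := {mpoly K[2]}.
Local Notation V := 'cV[K]_2.
Implicit Types (p q : S) (v w x : V).

Lemma col2P v w : v ord0 ord0 = w ord0 ord0 ->
  v (lift ord0 ord0) ord0 = w (lift ord0 ord0) ord0 -> v = w.
Proof.
move=> e0 e1; apply/colP => i; case: (unliftP ord0 i) => [j|] -> //.
by have -> : j = ord0 by exact: ord1.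
Qed.

Lemma evalpD p q v : evalp (p + q) v = evalp p v + evalp q v.
Proof. exact: mevalD. Qed.
Lemma evalpN p v : evalp (- p) v = - evalp p v.
Proof. exact: mevalN. Qed.
Lemma evalpB p q v : evalp (p - q) v = evalp p v - evalp q v.
Proof. exact: mevalB. Qed.
Lemma evalpM p q v : evalp (p * q) v = evalp p v * evalp q v.
Proof. exact: mevalM. Qed.
Lemma evalpC c v : evalp (c%:MP) v = c.
Proof. exact: mevalC. Qed.
Lemma evalp0 v : evalp 0 v = 0.
Proof. exact: meval0. Qed.
Lemma evalp1 v : evalp 1 v = 1.
Proof. exact: meval1. Qed.
Lemma evalpX i v : evalp 'X_i v = v i ord0.
Proof. exact: mevalXU. Qed.
Lemma evalpZ c p v : evalp (c *: p) v = c * evalp p v.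
Proof. exact: mevalZ. Qed.
Lemma evalpXn p n v : evalp (p ^+ n) v = evalp p v ^+ n.
Proof. by rewrite /evalp rmorphXn. Qed.
Lemma evalp_sum I (r : seq I) (P : pred I) (F : I -> S) v :
  evalp (\sum_(i <- r | P i) F i) v = \sum_(i <- r | P i) evalp (F i) v.
Proof. by rewrite /evalp raddf_sum. Qed.
Lemma evalp_prod I (r : seq I) (P : pred I) (F : I -> S) v :
  evalp (\prod_(i <- r | P i) F i) v = \prod_(i <- r | P i) evalp (F i) v.
Proof. by rewrite /evalp rmorph_prod. Qed.
Definition evalpE :=
  (evalpD, evalpN, evalpB, evalpM, evalpC, evalp0, evalp1, evalpX, evalpZ,
   evalpXn, evalp_sum, evalp_prod).

(** Kronecker substitution: for [M] larger than the degree, [x = t], [y = t ^+ M]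
    maps distinct monomials of [p] to distinct powers of [t]. *)
Lemma evalp_eq0 p : (forall v, evalp p v = 0) -> p = 0.
Proof.
move=> p0; set M := msize p.
pose q := \sum_(m <- msupp p) p@_m *: 'X^(m ord0 + M * m (lift ord0 ord0)).
have q0 : q = 0.
  apply: poly_fun0 => t _.
  rewrite -[RHS](p0 (\col_i (if i == ord0 then t else t ^+ M))) /evalp mevalE.
  rewrite horner_sum; apply: eq_bigr => m _.
  rewrite hornerZ hornerXn big_ord_recl big_ord1 !mxE /=.
  by rewrite exprD exprM.
apply/mpolyP => m; rewrite mcoeff0.
have [mp|/memN_msupp_eq0//] := boolP (m \in msupp p).
have lt_M (m' : 'X_{1..2}) i : m' \in msupp p -> (m' i < M)%N.
  move/msize_mdeg_lt; apply: leq_ltn_trans.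
  by rewrite mdegE (bigD1 i) //= leq_addr.
have := congr1 (fun r : {poly K} => r`_(m ord0 + M * m (lift ord0 ord0))) q0.
rewrite coef0 coef_sum (bigD1_seq m) //= coefZ coefXn eqxx mulr1 big_seq_cond.
rewrite big1 ?addr0 // => m' /andP[m'p m'm]; rewrite coefZ coefXn.
case: eqP => [E|]; last by rewrite mulr0.
have m0 := lt_M _ ord0 mp; have m0' := lt_M _ ord0 m'p.
have M0 : (0 < M)%N by apply: leq_ltn_trans m0.
have e0 : m ord0 = m' ord0.
  have := congr1 (fun k => k %% M)%N E.
  by rewrite !(mulnC M) !(addnC _ (_ * M)) !modnMDl !modn_small.
have e1 : m (lift ord0 ord0) = m' (lift ord0 ord0).
  by move: E; rewrite e0 => /eqP; rewrite eqn_add2l eqn_pmul2l // => /eqP.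
case/eqP: m'm; apply/mnmP => i; case: (unliftP ord0 i) => [j|] -> //.
by rewrite (ord1 j).
Qed.

Lemma evalp_inj p q : (forall v, evalp p v = evalp q v) -> p = q.
Proof.
move=> pq; apply/eqP; rewrite -subr_eq0; apply/eqP/evalp_eq0 => v.
by rewrite evalpB pq subrr.
Qed.

(** The origin is excluded by multiplying [p] with a coordinate. *)
Lemma evalp_neq0 p : p != 0 -> exists2 v : V, v != 0 & evalp p v != 0.
Proof.
move=> p0; have : p * 'X_ord0 != 0.
  rewrite mulf_neq0 //; apply/eqP => X0.
  have := congr1 (fun r => evalp r (const_mx 1)) X0.
  by rewrite evalpX evalp0 mxE => /eqP; rewrite oner_eq0.
move=> pX; apply: contrapT => H; case/eqP: pX; apply: evalp_eq0 => v.
rewrite evalpM evalpX; have [->|v0] := eqVneq v 0; first by rewrite mxE mulr0.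
have [->|pv] := eqVneq (evalp p v) 0; first by rewrite mul0r.
by case: H; exists v; rewrite ?pv.
Qed.

(** The polynomial in [t] obtained at [v + t *: xi]: degrees, differentials and
    homogeneous components are all read off from such restrictions to lines. *)
Definition linep p v (xi : V) : {poly K} :=
  mmap (@polyC K) (fun i => (v i ord0)%:P + xi i ord0 *: 'X) p.

Lemma horner_linep p v xi t : (linep p v xi).[t] = evalp p (v + t *: xi).
Proof.
elim/mpoly_ring_ind: p => [c|i|p q IHp IHq|p q IHp IHq].
- by rewrite /linep mmapC hornerC evalpC.
- rewrite /linep mmapX mmap1U evalpX !mxE hornerD hornerC hornerZ hornerX.
  by rewrite mulrC.
- by rewrite /linep mmapD hornerD -/(linep _ _ _) IHp -/(linep _ _ _) IHq evalpD.
- by rewrite /linep rmorphM hornerM -/(linep _ _ _) IHp -/(linep _ _ _) IHq evalpM.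
Qed.

Lemma size_linep p : exists d, forall v xi, (size (linep p v xi) <= d)%N.
Proof.
elim/mpoly_ring_ind: p => [c|i|p q [d pd] [e qe]|p q [d pd] [e qe]].
- by exists 1%N => v xi; rewrite /linep mmapC size_polyC leq_b1.
- exists 2%N => v xi; rewrite /linep mmapX mmap1U.
  apply: leq_trans (size_polyD _ _) _; rewrite geq_max; apply/andP; split.
    by rewrite size_polyC; case: (_ != 0).
  by apply: leq_trans (size_scale_leq _ _) _; rewrite size_polyX.
- exists (maxn d e) => v xi; rewrite /linep mmapD.
  by apply: leq_trans (size_polyD _ _) _; rewrite geq_max !leq_max pd qe orbT.
- exists (d + e)%N => v xi; rewrite /linep rmorphM /=.
  apply: leq_trans (size_polyMleq _ _) _; apply: leq_trans (leq_pred _) _.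
  by apply: leq_add; [exact: pd|exact: qe].
Qed.

Lemma lineP p q v xi w eta :
  (forall t, t != 0 -> evalp p (v + t *: xi) = evalp q (w + t *: eta)) ->
  linep p v xi = linep q w eta.
Proof. by move=> pq; apply: poly_fun_inj => t t0; rewrite !horner_linep pq. Qed.

(** The directional derivative, defined by restriction to a line so that the
    chain rule for linear substitutions is immediate. *)
Definition dder v (xi : V) p : K := (linep p v xi)^`().[0].

Lemma dderE v xi p : dder v xi p = \sum_i xi i ord0 * evalp p^`M(i) v.
Proof.
rewrite /dder; elim/mpoly_ring_ind: p => [c|i|p q IHp IHq|p q IHp IHq].
- rewrite /linep mmapC derivC horner0 big1// => i _.
  by rewrite mderivC evalp0 mulr0.
- rewrite /linep mmapX mmap1U derivD derivC derivZ derivX add0r hornerZ hornerC.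
  rewrite (bigD1 i)//= mderivX mnm1E eqxx big1 ?addr0 => [|j ji].
    by rewrite -{1}[U_(i)%MM]add0m addmK mpolyX0 scale1r evalp1.
  by rewrite mderivX mnm1E eq_sym (negPf ji) scale0r evalp0 mulr0.
- rewrite /linep mmapD derivD hornerD -/(linep _ _ _) IHp -/(linep _ _ _) IHq.
  by rewrite -big_split; apply: eq_bigr => i _; rewrite mderivD evalpD mulrDr.
- rewrite /linep rmorphM derivM hornerD !hornerM -/(linep _ _ _) -/(linep _ _ _).
  rewrite IHp IHq !horner_linep scale0r addr0 mulr_suml mulr_sumr -big_split.
  apply: eq_bigr => i _; rewrite mderivM evalpD !evalpM /=; ring.
Qed.

Lemma dderD v xi p q : dder v xi (p + q) = dder v xi p + dder v xi q.
Proof. by rewrite /dder /linep mmapD derivD hornerD. Qed.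
Lemma dderB v xi p q : dder v xi (p - q) = dder v xi p - dder v xi q.
Proof. by rewrite /dder /linep mmapB derivB hornerD hornerN. Qed.
Lemma dderC v xi c : dder v xi c%:MP = 0.
Proof. by rewrite /dder /linep mmapC derivC horner0. Qed.
Lemma dderM v xi p q :
  dder v xi (p * q) = dder v xi p * evalp q v + evalp p v * dder v xi q.
Proof.
rewrite /dder /linep rmorphM derivM hornerD !hornerM -/(linep _ _ _).
by rewrite -/(linep q _ _) !horner_linep scale0r addr0.
Qed.
Lemma dderZ v xi c p : dder v xi (c *: p) = c * dder v xi p.
Proof. by rewrite -mul_mpolyC dderM dderC mul0r add0r evalpC. Qed.
Lemma dder_sum v xi I (r : seq I) (P : pred I) (F : I -> S) :
  dder v xi (\sum_(i <- r | P i) F i) = \sum_(i <- r | P i) dder v xi (F i).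
Proof.
apply: (big_morph (dder v xi)); first exact: dderD.
by rewrite -(mpolyC0 2 K) dderC.
Qed.
Lemma dderX v xi i : dder v xi 'X_i = xi i ord0.
Proof.
rewrite /dder /linep mmapX mmap1U derivD derivC derivZ derivX add0r.
by rewrite hornerZ hornerC mulr1.
Qed.
Lemma dder_linear v xi eta a p :
  dder v (a *: xi + eta) p = a * dder v xi p + dder v eta p.
Proof.
rewrite !dderE mulr_sumr -big_split; apply: eq_bigr => i _.
by rewrite !mxE mulrDl mulrA.
Qed.

Lemma dder_comp (g : 'M[K]_2) p q v xi :
  (forall x, evalp q x = evalp p (g *m x)) ->
  dder v xi q = dder (g *m v) (g *m xi) p.
Proof.
move=> qp; rewrite /dder; congr (_^`().[0]); apply: lineP => t _.
by rewrite qp mulmxDr scalemxAr.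
Qed.

End Plane.

(** * Regular functions on the plane *)

Section RegularPlane.
Variable K : numClosedFieldType.
Local Notation S := {mpoly K[2]}.
Local Notation V := 'cV[K]_2.
Local Notation A2 := (affine_space K 2).

Lemma zariski_nbhs (x : A2) (N : set A2) : nbhs x N <->
  exists2 h : S, evalp h x != 0 & forall y, evalp h y != 0 -> N y.
Proof.
split=> [|[h hx hN]].
  rewrite nbhsE => -[B [oB Bx] BN].
  have /zariski_openP/(_ x Bx)[h hx hB] : zariski_open B by [].
  by exists h => // y /hB/BN.
rewrite nbhsE; exists [set y | evalp h y != 0] => //; split=> //.
by apply/zariski_openP => y hy; exists h.
Qed.

(** Multiplying by a polynomial that vanishes off a neighbourhood turns a local
    expression as a quotient into an identity that holds everywhere. *)
Lemma regular_planeP (x : A2) (f : A2 -> K) : regular_at x f <->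
  exists p q : S, evalp q x != 0 /\ forall y, evalp q y * f y = evalp p y.
Proof.
split=> [[p [q [qx /zariski_nbhs[h hx hf]]]]|[p [q [qx qf]]]].
  have := hf x hx.
  exists (h * q * p), (h * q * q); split; first by rewrite !evalpE !mulf_neq0.
  move=> y; rewrite !evalpE.
  have [->|hy] := eqVneq (evalp h y) 0; first by rewrite !mul0r.
  have [->|qy] := eqVneq (evalp q y) 0; first by rewrite !(mulr0, mul0r).
  by rewrite hf// -!mulrA; congr (_ * (_ * _)); rewrite mulrC divfK.
exists p, q; split=> //; apply/zariski_nbhs; exists q => // y qy.
by rewrite -qf mulrAC divff// mul1r.
Qed.

(** On the line: write the function near [0] as a reduced fraction; at a root of
    the denominator a second local expression would make the numerator vanish
    too. *)
Lemma regular_line (F : K -> K) :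
  (forall t0, exists a b : {poly K},
     b.[t0] != 0 /\ forall t, b.[t] * F t = a.[t]) ->
  exists c : {poly K}, forall t, F t = c.[t].
Proof.
move=> FE; have [a0 [b0 [b00 b0F]]] := FE 0.
have b0n0 : b0 != 0 by apply: contraNneq b00 => ->; rewrite horner0.
have [[a1 b1] /= [E1 E2 cop]] : exists ab : {poly K} * {poly K},
   [/\ a0 = ab.1 * gcdp a0 b0, b0 = ab.2 * gcdp a0 b0 & coprimep ab.1 ab.2].
  exists (a0 %/ gcdp a0 b0, b0 %/ gcdp a0 b0); split => /=.
  - by rewrite divpK ?dvdp_gcdl.
  - by rewrite divpK ?dvdp_gcdr.
  - by rewrite coprimep_div_gcd// b0n0 orbT.
set g := gcdp a0 b0 in E1 E2.
have gn0 : g != 0 by apply: contraNneq b0n0 => g0; rewrite E2 g0 mulr0.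
have cross a b : (forall t, b.[t] * F t = a.[t]) -> b1 * a = b * a1.
  move=> bF; apply: (mulIf gn0); rewrite mulrAC -E2 -mulrA -E1.
  by apply: poly_fun_inj => t _; rewrite !hornerM -bF -b0F; ring.
have nroot t : b1.[t] != 0.
  have [a [b [bt /cross ba]]] := FE t; apply/eqP => b1t.
  have := congr1 (horner^~ t) ba; rewrite !hornerM b1t mul0r => /esym/eqP.
  rewrite mulf_eq0 (negPf bt) /= => a1t.
  have := @coprimep_root _ a1 b1 t cop a1t; by rewrite b1t eqxx.
have [c cn0 b1c] : exists2 c, c != 0 & b1 = c%:P.
  have sz : size b1 == 1%N.
    apply/negPn/negP => /(closed_rootP b1)[t].
    by rewrite /root => /eqP; exact/eqP.
  have [c cn0 ->] := size_poly1P b1 sz; by exists c.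
exists (c^-1 *: a1) => t; have [a [b [bt bF]]] := FE t.
have := congr1 (horner^~ t) (cross _ _ bF).
rewrite b1c !hornerM !hornerC hornerZ -bF mulrCA => /(mulfI bt) <-.
by rewrite mulKf.
Qed.

Definition upoly i (c : {poly K}) : S := (map_poly (@mpolyC 2 K) c).['X_i].

Lemma evalp_upoly i c v : evalp (upoly i c) v = c.[v i ord0].
Proof.
rewrite /upoly; elim/poly_ind: c => [|c a IH].
  by rewrite rmorph0 !horner0 evalp0.
rewrite rmorphD rmorphM /= map_polyX map_polyC /= !(hornerD,hornerM,hornerX,hornerC).
by rewrite evalpD evalpM evalpX evalpC IH.
Qed.

(** Slices are polynomial by the case of the line; along almost all vertical
    lines the degree is bounded by that of one fixed numerator, so the function
    is interpolated there from finitely many horizontal slices, and it agrees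
    with the interpolant on every horizontal line off finitely many points. *)
Lemma regular_plane_poly (f : A2 -> K) : (forall x, regular_at x f) ->
  exists p : S, forall v, f v = evalp p v.
Proof.
move=> freg.
have fE x : exists p q : S, evalp q x != 0 /\
  forall y, evalp q y * f y = evalp p y by exact/regular_planeP/freg.
have slice (v xi : V) : exists c : {poly K}, forall t, f (v + t *: xi) = c.[t].
  apply: regular_line => t0; have [p [q [qx qf]]] := fE (v + t0 *: xi).
  exists (linep p v xi), (linep q v xi); rewrite horner_linep; split=> // t.
  by rewrite !horner_linep qf.
have [p [q [q0 qf]]] := fE 0.
pose i0 : 'I_2 := ord0; pose i1 : 'I_2 := lift ord0 ord0.
pose e0 : V := delta_mx i0 ord0; pose e1 : V := delta_mx i1 ord0.
have decomp (v : V) : v = v i0 ord0 *: e0 + v i1 ord0 *: e1.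
  by apply: col2P; rewrite !mxE /= ?(mulr0,mulr1,addr0,add0r).
have [d dP] := size_linep p.
have vert x : linep q (x *: e0) e1 != 0 ->
  exists2 c : {poly K}, (size c <= d.+1)%N &
    forall y, f (x *: e0 + y *: e1) = c.[y].
  move=> qx; have [c cE] := slice (x *: e0) e1; exists c => //.
  have E : linep q (x *: e0) e1 * c = linep p (x *: e0) e1.
    by apply: poly_fun_inj => t _; rewrite hornerM !horner_linep -cE qf.
  have [->|cn0] := eqVneq c 0; first by rewrite size_poly0.
  apply: leqW; apply: leq_trans (dP (x *: e0) e1); rewrite -E size_mul//.
  by have := qx; rewrite -size_poly_gt0; case: (size _) => // n _; rewrite leq_addl.
have [h hE] := choice (fun y => slice (y *: e1) e0).
pose L (i : 'I_d.+1) : {poly K} := (tnth (lagrange d.+1 (fun j : nat => j%:R : K)) i).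
(* [P] interpolates the horizontal slices at the ordinates [0], ..., [d]. *)
pose P : S := \sum_(i < d.+1) upoly i0 (h i%:R) * upoly i1 (L i).
have ninj : injective (fun j : nat => j%:R : K).
  by move=> i j /eqP; rewrite eqr_nat => /eqP.
have good x y : linep q (x *: e0) e1 != 0 ->
    f (x *: e0 + y *: e1) = evalp P (x *: e0 + y *: e1).
  move=> /vert[c sc cE]; rewrite cE (lagrange_gen _ ninj sc)// horner_sum.
  rewrite /P evalp_sum; apply: eq_bigr => i _; rewrite hornerM hornerC evalpM.
  rewrite !evalp_upoly -cE addrC hE !mxE /= !(mulr0,mulr1,addr0,add0r).
  by congr (_ * _).
have rn0 : linep q 0 e0 != 0.
  by apply: contraNneq q0 => /(congr1 (horner^~ 0));
    rewrite horner_linep scale0r addr0 horner0 => ->.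
exists P => v; rewrite (decomp v); set x := v i0 _; set y := v i1 _.
have E : h y = linep P (y *: e1) e0.
  apply: (mulfI rn0); apply: poly_fun_inj => t _; rewrite !hornerM -hE !horner_linep.
  have [->|qt] := eqVneq (evalp q (0 + t *: e0)) 0; first by rewrite !mul0r.
  congr (_ * _); rewrite addrC good//; apply: contraNneq qt.
  move=> /(congr1 (horner^~ 0)); rewrite horner_linep scale0r addr0 horner0 add0r.
  by move=> ->.
by rewrite addrC hE E horner_linep.
Qed.

End RegularPlane.

(** * Invariants and the topology and functions of the quotient *)

Section Invariants.
Variables (K : numClosedFieldType) (G : finite_subgroup_GL2 K).
Local Notation S := {mpoly K[2]}.
Local Notation V := 'cV[K]_2.
Implicit Types (p q F : S) (v w : V) (g h : 'M[K]_2).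

Lemma gelems_exists : exists s : seq 'M[K]_2, uniq s /\ forall g, g \in s <-> G g.
Proof.
have /finite_seqP[s Gs] := gl2_finite G.
exists (undup s); split; first exact: undup_uniq.
by move=> g; rewrite mem_undup Gs.
Qed.

Definition gelems := projT1 (cid gelems_exists).

Lemma gelems_uniq : uniq gelems.
Proof. by rewrite /gelems; case: cid => s []. Qed.

Lemma mem_gelems g : g \in gelems <-> G g.
Proof. by rewrite /gelems; case: cid => s []. Qed.

Lemma gelems_mulr h : G h -> perm_eq [seq g *m h | g <- gelems] gelems.
Proof.
move=> Gh; have uh := gl2_unit Gh.
have inj : injective (fun g => g *m h) by apply: can_inj (mulmxK uh).
apply: uniq_perm; rewrite ?map_inj_uniq ?gelems_uniq// => k.
apply/mapP/idP => [[g /mem_gelems Gg ->]|/mem_gelems Gk].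
  by apply/mem_gelems; exact: gl2_mul.
exists (k *m invmx h); last by rewrite mulmxKV.
by apply/mem_gelems/gl2_mul => //; exact: gl2_inv.
Qed.

Definition act g p : S := p \mPo [tuple \sum_j g i j *: 'X_j | i < 2].

Lemma evalp_act g p v : evalp (act g p) v = evalp p (g *m v).
Proof.
rewrite /evalp comp_mpoly_meval; apply: meval_eq => i.
rewrite tnth_mktuple -/(evalp _ v) evalp_sum mxE; apply: eq_bigr => j _.
by rewrite evalpZ evalpX.
Qed.

Definition Ginvariant p := forall g, G g -> forall v, evalp p (g *m v) = evalp p v.

Lemma GinvariantC c : Ginvariant c%:MP.
Proof. by move=> g _ v; rewrite !evalpC. Qed.
Lemma Ginvariant0 : Ginvariant 0.
Proof. by move=> g _ v; rewrite !evalp0. Qed.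
Lemma Ginvariant1 : Ginvariant 1.
Proof. by move=> g _ v; rewrite !evalp1. Qed.
Lemma GinvariantD p q : Ginvariant p -> Ginvariant q -> Ginvariant (p + q).
Proof. by move=> ip iq g Gg v; rewrite !evalpD ip ?iq. Qed.
Lemma GinvariantB p q : Ginvariant p -> Ginvariant q -> Ginvariant (p - q).
Proof. by move=> ip iq g Gg v; rewrite !evalpB ip ?iq. Qed.
Lemma GinvariantM p q : Ginvariant p -> Ginvariant q -> Ginvariant (p * q).
Proof. by move=> ip iq g Gg v; rewrite !evalpM ip ?iq. Qed.
Lemma GinvariantZ c p : Ginvariant p -> Ginvariant (c *: p).
Proof. by move=> ip g Gg v; rewrite !evalpZ ip. Qed.
Lemma Ginvariant_sum I (r : seq I) (P : pred I) (F : I -> S) :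
  (forall i, P i -> Ginvariant (F i)) -> Ginvariant (\sum_(i <- r | P i) F i).
Proof. by move=> iF; apply: big_ind => [|p q|i]; [exact: Ginvariant0|exact: GinvariantD|exact: iF]. Qed.

(** The Reynolds operator up to the order of the group: what matters is that it
    maps to the invariants and is linear over them. *)
Definition Tr p : S := \sum_(g <- gelems) act g p.

Lemma evalp_Tr p v : evalp (Tr p) v = \sum_(g <- gelems) evalp p (g *m v).
Proof. by rewrite evalp_sum; apply: eq_bigr => g _; rewrite evalp_act. Qed.

Lemma Ginvariant_Tr p : Ginvariant (Tr p).
Proof.
move=> h Gh v; rewrite !evalp_Tr -[in RHS](perm_big _ (gelems_mulr Gh)) big_map.
by apply: eq_bigr => g _; rewrite mulmxA.
Qed.

Lemma TrD p q : Tr (p + q) = Tr p + Tr q.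
Proof.
apply: evalp_inj => v; rewrite evalpD !evalp_Tr -big_split.
by apply: eq_bigr => g _; rewrite evalpD.
Qed.

Lemma Tr_invM p F : Ginvariant p -> Tr (p * F) = p * Tr F.
Proof.
move=> ip; apply: evalp_inj => v; rewrite evalpM !evalp_Tr mulr_sumr.
rewrite big_seq [RHS]big_seq; apply: eq_bigr => g /mem_gelems Gg.
by rewrite evalpM ip.
Qed.

Lemma Tr_inv p : Ginvariant p -> Tr p = (size gelems)%:R *: p.
Proof.
move=> ip; apply: evalp_inj => v; rewrite evalp_Tr evalpZ big_seq.
rewrite (eq_bigr (fun=> evalp p v)) => [|g /mem_gelems Gg]; last exact: ip.
by rewrite -big_seq big_const_seq count_predT iter_addr_0 mulr_natl.
Qed.

Lemma size_gelems_gt0 : (0 < size gelems)%N.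
Proof.
have : 1%:M \in gelems by apply/mem_gelems; exact: gl2_1.
by case: gelems.
Qed.

Lemma size_gelems_neq0 : (size gelems)%:R != 0 :> K.
Proof. by rewrite pnatr_eq0 -lt0n size_gelems_gt0. Qed.

(** Its coefficients are invariant, so that every polynomial is integral over the
    invariants. *)
Definition charp p : {poly S} := \prod_(g <- gelems) ('X - (act g p)%:P).
Definition charp_at p v : {poly K} :=
  \prod_(g <- gelems) ('X - (evalp p (g *m v))%:P).

Lemma evalp_charp p v i : evalp (charp p)`_i v = (charp_at p v)`_i.
Proof.
rewrite /evalp -coef_map; congr ((polyseq _)`_ _).
rewrite /charp /charp_at rmorph_prod. apply: eq_bigr => g _.
by rewrite rmorphB /= map_polyX map_polyC /= -/(evalp _ v) evalp_act.
Qed.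

Lemma Ginvariant_charp p i : Ginvariant (charp p)`_i.
Proof.
move=> h Gh v; rewrite !evalp_charp /charp_at.
rewrite -[in RHS](perm_big _ (gelems_mulr Gh)) big_map; congr ((polyseq _)`_ _).
by apply: eq_bigr => g _; rewrite mulmxA.
Qed.

Lemma act1 p : act 1%:M p = p.
Proof. by apply: evalp_inj => v; rewrite evalp_act mul1mx. Qed.

Lemma charp_root p : (charp p).[p] = 0.
Proof.
have G1 : 1%:M \in gelems by apply/mem_gelems; exact: gl2_1.
rewrite /charp (bigD1_seq _ G1 gelems_uniq) hornerM /=.
by rewrite hornerXsubC act1 subrr mul0r.
Qed.

Lemma charp_at_root p v : root (charp_at p v) (evalp p v).
Proof.
apply/rootP; rewrite /charp_at horner_prod; apply/eqP; rewrite prodf_seq_eq0.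
apply/hasP; exists 1%:M; first by apply/mem_gelems; exact: gl2_1.
by rewrite mul1mx hornerXsubC subrr eqxx.
Qed.

Lemma size_charp p : size (charp p) = (size gelems).+1.
Proof. exact: size_prod_XsubC. Qed.

Lemma size_charp_at p v : size (charp_at p v) = (size gelems).+1.
Proof. exact: size_prod_XsubC. Qed.

Lemma exists_notin (B : seq K) : exists c, c \notin B.
Proof.
apply: contrapT => H; have : \prod_(b <- B) ('X - b%:P) = 0 :> {poly K}.
  apply: poly_fun0 => t _; apply/eqP.
  have := root_prod_XsubC B t; rewrite /root => ->; apply/negPn/negP => tB; apply: H; by exists t.
by move/eqP; rewrite prodf_seq_eq0 => /hasP[b _] /=; rewrite polyXsubC_eq0.
Qed.

Definition linform (c : K) : S := 'X_ord0 + c *: 'X_(lift ord0 ord0).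

Lemma evalp_linform c v :
  evalp (linform c) v = v ord0 ord0 + c * v (lift ord0 ord0) ord0.
Proof. by rewrite evalpD evalpZ !evalpX. Qed.

Definition separates c w :=
  forall g, G g -> g *m w != w -> evalp (linform c) (g *m w) != evalp (linform c) w.

(** Each nonzero vector excludes one value of [c]. *)
Lemma linform_avoid (us : seq V) (B : seq K) : exists2 c, c \notin B &
  forall u, u \in us -> u != 0 -> evalp (linform c) u != 0.
Proof.
pose bad (u : V) := - u ord0 ord0 / u (lift ord0 ord0) ord0.
have [c] := exists_notin (B ++ [seq bad u | u <- us]).
rewrite mem_cat negb_or => /andP[cB cbad]; exists c => // u uus u0.
rewrite evalp_linform.
have [u1|u1] := eqVneq (u (lift ord0 ord0) ord0) 0.
  rewrite u1 mulr0 addr0; apply: contraNneq u0 => uu0.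
  by apply/eqP/col2P; rewrite ?u1 ?uu0 [RHS]mxE.
apply: contraNneq cbad => E; apply/mapP; exists u => //.
apply: (mulIf u1); rewrite /bad divfK//.
by apply/eqP; rewrite -addr_eq0 addrC E.
Qed.

Lemma linformB c v w :
  evalp (linform c) (v - w) = evalp (linform c) v - evalp (linform c) w.
Proof. by rewrite !evalp_linform !mxE; ring. Qed.

Lemma separating w (B : seq K) : exists2 c, c \notin B & separates c w.
Proof.
have [c cB cu] := linform_avoid [seq g *m w - w | g <- gelems] B.
exists c => // g Gg gw; rewrite -subr_eq0 -linformB.
by apply: cu; [apply/map_f/mem_gelems|rewrite subr_eq0].
Qed.

(** Multiplying by it before taking the trace isolates the contribution of [w]
    among those of the points of its orbit. *)
Definition orbit_bump c w : S :=
  \prod_(g <- gelems | g *m w != w)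
     (linform c - (evalp (linform c) (g *m w))%:MP).

Lemma bump_neq0 c w : separates c w -> evalp (orbit_bump c w) w != 0.
Proof.
move=> sep; rewrite /orbit_bump evalp_prod prodf_seq_neq0.
apply/allP => g /mem_gelems Gg; apply/implyP => gw.
by rewrite evalpB evalpC subr_eq0 eq_sym sep.
Qed.

Lemma bump_eq0 c w g : G g -> g *m w != w -> evalp (orbit_bump c w) (g *m w) = 0.
Proof.
move=> /mem_gelems Gg gw; apply/eqP; rewrite /orbit_bump evalp_prod prodf_seq_eq0.
by apply/hasP; exists g; rewrite // gw evalpB evalpC subrr eqxx.
Qed.

Lemma Tr_bump c w : separates c w ->
  exists2 n : K, n != 0 & forall F, evalp (Tr (orbit_bump c w * F)) w = n * evalp F w.
Proof.
move=> sep; exists ((count (fun g => g *m w == w) gelems)%:R * evalp (orbit_bump c w) w).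
  rewrite mulf_neq0 ?bump_neq0// pnatr_eq0 -lt0n -has_count.
  by apply/hasP; exists 1%:M; rewrite ?mul1mx//; apply/mem_gelems; exact: gl2_1.
move=> F; rewrite evalp_Tr big_seq (bigID (fun g => g *m w == w))/=.
rewrite [X in _ + X]big1 ?addr0 => [|g /andP[/mem_gelems Gg gw]]; last first.
  by rewrite evalpM bump_eq0 ?mul0r.
rewrite (eq_bigr (fun=> evalp (orbit_bump c w) w * evalp F w)); last first.
  by move=> g /andP[_ /eqP ->]; rewrite evalpM.
by rewrite -big_seq_cond big_const_seq iter_addr_0 -[RHS]mulrA mulr_natl.
Qed.

Local Notation A2 := (affine_space K 2).
Local Notation pi v := (quotient_pi (orbit_equiv G) (v : V) : quotA2 G).

Lemma piP v w : pi v = pi w <-> exists2 g, G g & w = g *m v.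
Proof. by rewrite quotient_piP; split => [/asboolP|H]; last exact/asboolP. Qed.

Lemma pi_act g v : G g -> pi (g *m v) = pi v.
Proof. by move=> Gg; apply/esym/piP; exists g. Qed.

(** The characteristic polynomial of a generic linear form determines the values
    of that form on the orbit. *)
Lemma invariants_separate v w :
  (forall f, Ginvariant f -> evalp f v = evalp f w) -> pi v = pi w.
Proof.
move=> vw; have [c _ cu] := linform_avoid [seq g *m v - w | g <- gelems] [::].
have vw_charp : charp_at (linform c) v = charp_at (linform c) w.
  apply/polyP => i; rewrite -!evalp_charp; apply: vw; exact: Ginvariant_charp.
have : root (charp_at (linform c) w) (evalp (linform c) w).
  exact: charp_at_root.
rewrite -vw_charp /charp_at /root horner_prod prodf_seq_eq0 => /hasP[g gG].
rewrite hornerXsubC subr_eq0 => /eqP E; apply/piP; exists g; first exact/mem_gelems.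
apply/eqP; rewrite eq_sym -subr_eq0; apply/negPn/negP => gv.
have := cu (g *m v - w) (map_f _ gG) gv.
by rewrite linformB E subrr eqxx.
Qed.

Definition lift_pt (x : quotA2 G) : V := @quotient_repr K A2 (orbit_equiv G) x.

Lemma pi_lift x : pi (lift_pt x) = x.
Proof. exact: quotient_reprK. Qed.

Lemma Ginvariant_pi p v w : Ginvariant p -> pi v = pi w -> evalp p v = evalp p w.
Proof. by move=> ip /piP[g Gg ->]; rewrite ip. Qed.

(** Principal open sets of invariants form a basis: given a polynomial that
    vanishes off a saturated open set, take the trace of its product with a
    bump. *)
Lemma quot_nbhsP w (N : set (quotA2 G)) : nbhs (pi w) N <->
  exists p, [/\ Ginvariant p, evalp p w != 0 & forall v, evalp p v != 0 -> N (pi v)].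
Proof.
split=> [|[p [ip pw pN]]].
  rewrite nbhsE => -[B [oB Bw] BN].
  have : nbhs (w : A2) [set v : A2 | B (pi v)].
    by apply: (@pi_continuous A2 _ w); apply: open_nbhs_nbhs.
  case/zariski_nbhs => h hw hB; have [c _ sep] := separating w [::].
  have [n n0 nE] := Tr_bump sep.
  exists (Tr (orbit_bump c w * h)); split; [exact: Ginvariant_Tr|by rewrite nE mulf_neq0|].
  move=> v; apply: contraNP => /(contra_not (BN _)) nB.
  rewrite evalp_Tr big1_seq// => g /andP[_ /mem_gelems Gg].
  rewrite evalpM; have [->|/hB/=] := eqVneq (evalp h (g *m v)) 0.
    by rewrite mulr0.
  by rewrite pi_act.
rewrite nbhsE; exists [set q | evalp p (lift_pt q) != 0].
  split; last by rewrite /= (@Ginvariant_pi p _ w) ?pi_lift.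
  apply/zariski_openP => v /= pv; exists p.
    by rewrite -(@Ginvariant_pi p (lift_pt (pi v))) ?pi_lift.
  by move=> y py; rewrite /= (@Ginvariant_pi p _ y) ?pi_lift.
by move=> q /= /pN; rewrite pi_lift.
Qed.

(** An identity [q * f = p] on the whole plane, for an invariant function [f],
    remains true after multiplication by a bump and taking traces. *)
Lemma regular_quotP w (f : quotA2 G -> K) : regular_at (pi w) f <->
  exists p q, [/\ Ginvariant p, Ginvariant q, evalp q w != 0 &
    forall v, evalp q v * f (pi v) = evalp p v].
Proof.
split=> [/nbhs_singleton/(_ w erefl)/regular_planeP[p [q [qw qf]]]|].
  have [c _ sep] := separating w [::]; have [n n0 nE] := Tr_bump sep.
  exists (Tr (orbit_bump c w * p)), (Tr (orbit_bump c w * q)).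
  split; [exact: Ginvariant_Tr|exact: Ginvariant_Tr|by rewrite nE mulf_neq0|].
  move=> v; rewrite !evalp_Tr mulr_suml big_seq [RHS]big_seq.
  apply: eq_bigr => g /mem_gelems Gg; rewrite !evalpM -mulrA; congr (_ * _).
  by rewrite -(pi_act v Gg); exact: qf.
move=> [p [q [ip iq qw qf]]]; apply/quot_nbhsP; exists q; split=> // v qv x xv.
apply/regular_planeP; exists p, q; split=> //.
by rewrite (@Ginvariant_pi q _ v).
Qed.

End Invariants.

(** * Tangent vectors at a free orbit *)

Section Hadamard.
Variable K : numClosedFieldType.
Local Notation S := {mpoly K[2]}.
Local Notation V := 'cV[K]_2.
Implicit Types (p q f h F : S) (v w : V).

Definition linform_at (c : K) w : S := linform c - (evalp (linform c) w)%:MP.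

Lemma linform_at0 c w : evalp (linform_at c w) w = 0.
Proof. by rewrite evalpB evalpC subrr. Qed.

Lemma dder_linform_at c w v xi :
  dder v xi (linform_at c w) = xi ord0 ord0 + c * xi (lift ord0 ord0) ord0.
Proof. by rewrite dderB dderC subr0 dderD dderZ !dderX. Qed.

(** Hadamard's lemma in the coordinates given by two independent linear forms:
    the polynomials with such an expression form a ring containing the variables. *)
Lemma hadamard c c' w f : c != c' -> exists A B : S,
  f = (evalp f w)%:MP + A * linform_at c w + B * linform_at c' w.
Proof.
move=> cc'; have d0 : c - c' != 0 by rewrite subr_eq0.
have dE : (c - c')^-1%:MP * (c%:MP - c'%:MP) = 1 :> S.
  by rewrite -mpolyCB -mpolyCM mulVf.
elim/mpoly_ring_ind: f => [a|i|f g [A [B fE]] [A' [B' gE]]|f g [A [B fE]] [A' [B' gE]]].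
- by exists 0, 0; rewrite evalpC !mul0r !addr0.
- rewrite /linform_at /linform evalpX !evalp_linform -!mul_mpolyC.
  case: (unliftP ord0 i) => [j|] ->.
    have -> : j = ord0 by exact: ord1.
    exists ((c - c')^-1)%:MP, (- ((c - c')^-1)%:MP); rewrite !mpolyCD !mpolyCM.
    set x0 := 'X_ord0; set x1 := 'X_(lift ord0 ord0).
    transitivity ((w (lift ord0 ord0) ord0)%:MP +
       (c - c')^-1%:MP * (c%:MP - c'%:MP) * (x1 - (w (lift ord0 ord0) ord0)%:MP)).
      by rewrite dE mul1r addrC subrK.
    ring.
  exists (1 - c%:MP * ((c - c')^-1)%:MP), (c%:MP * ((c - c')^-1)%:MP).
  rewrite !mpolyCD !mpolyCM.
  set x0 := 'X_ord0; set x1 := 'X_(lift ord0 ord0).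
  transitivity ((w ord0 ord0)%:MP + (x0 - (w ord0 ord0)%:MP)
     + (1 - (c - c')^-1%:MP * (c%:MP - c'%:MP)) * c%:MP * (x1 - (w (lift ord0 ord0) ord0)%:MP)).
    by rewrite dE subrr !mul0r addr0 addrC subrK.
  ring.
- exists (A + A'), (B + B'); rewrite {1}fE {1}gE evalpD mpolyCD; ring.
- exists (A * g + (evalp f w)%:MP * A'), (B * g + (evalp f w)%:MP * B').
  rewrite {1}fE evalpM mpolyCM.
  transitivity ((evalp f w)%:MP * g + (A * linform_at c w + B * linform_at c' w) * g).
    ring.
  rewrite {1}gE; ring.
Qed.

Lemma linforms_free (c c' a b : K) : c != c' ->
  (forall xi : V, a * (xi ord0 ord0 + c * xi (lift ord0 ord0) ord0) +
     b * (xi ord0 ord0 + c' * xi (lift ord0 ord0) ord0) = 0) -> a = 0 /\ b = 0.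
Proof.
move=> cc' H.
have d0 : c - c' != 0 by rewrite subr_eq0.
split; apply: (mulIf d0); rewrite mul0r.
  rewrite -[RHS](H (\col_i if i == ord0 then - c' else 1)) !mxE /=; ring.
rewrite -[RHS]oppr0 -[in RHS](H (\col_i if i == ord0 then - c else 1)) !mxE /=.
ring.
Qed.

(** Taylor expansion at order two, by applying Hadamard's lemma twice. *)
Lemma hadamard2 c c' w h : c != c' -> evalp h w = 0 ->
  (forall xi, dder w xi h = 0) -> exists A B C : S,
  h = A * (linform_at c w * linform_at c w) + B * (linform_at c w * linform_at c' w)
      + C * (linform_at c' w * linform_at c' w).
Proof.
move=> cc' h0 dh; have [A [B hE]] := hadamard w h cc'.
have [Aw Bw] : evalp A w = 0 /\ evalp B w = 0.
  apply: (linforms_free cc') => xi; rewrite -[RHS](dh xi) {1}hE h0 mpolyC0 add0r.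
  by rewrite dderD !dderM !linform_at0 !mulr0 !add0r !dder_linform_at.
have [A1 [A2 AE]] := hadamard w A cc'; have [B1 [B2 BE]] := hadamard w B cc'.
exists A1, (A2 + B1), B2.
rewrite hE h0 mpolyC0 {1}AE {1}BE Aw Bw mpolyC0; ring.
Qed.

End Hadamard.

Section Smooth.
Variables (K : numClosedFieldType) (G : finite_subgroup_GL2 K).
Local Notation S := {mpoly K[2]}.
Local Notation V := 'cV[K]_2.
Implicit Types (p q f h F : S) (v w : V).

Definition free_point w := forall g, G g -> g *m w = w -> g = 1%:M.

Lemma small_free : small G -> forall w, w != 0 -> free_point w.
Proof.
move=> Gs w w0 g Gg gw; apply: contrapT => g1; apply: (Gs g Gg); split=> //.
by exists w => // a; rewrite -scalemxAr gw.
Qed.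

(** A point derivation of the ring of invariants at the orbit of [w]; only its
    values at invariants matter. *)
Definition derivation_at w (D : S -> K) :=
  [/\ forall c, D c%:MP = 0,
      forall f h, Ginvariant G f -> Ginvariant G h -> D (f + h) = D f + D h
    & forall f h, Ginvariant G f -> Ginvariant G h ->
        D (f * h) = D f * evalp h w + evalp f w * D h].

Section AtPoint.
Variable w : V.
Hypothesis free_w : free_point w.
Variable D : S -> K.
Hypothesis D_der : derivation_at w D.

Let DC c : D c%:MP = 0. Proof. by case: D_der. Qed.
Let DD f h : Ginvariant G f -> Ginvariant G h -> D (f + h) = D f + D h.
Proof. by case: D_der => _ H _; exact: H. Qed.
Let DM f h : Ginvariant G f -> Ginvariant G h -> D (f * h) = D f * evalp h w + evalp f w * D h.
Proof. by case: D_der => _ _ H; exact: H. Qed.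

Lemma derivation_sum I (r : seq I) (P : pred I) (F : I -> S) :
  (forall i, P i -> Ginvariant G (F i)) ->
  D (\sum_(i <- r | P i) F i) = \sum_(i <- r | P i) D (F i).
Proof.
move=> iF; elim: r => [|i r IH]; first by rewrite !big_nil -(mpolyC0 2 K).
rewrite !big_cons; case: ifP => Pi //; rewrite DD ?IH//; first exact: iF.
exact: Ginvariant_sum.
Qed.

Lemma act_neq g : G g -> (g *m w != w) = (g != 1%:M).
Proof.
by move=> Gg; congr negb; apply/eqP/eqP => [/(free_w Gg)|->]; rewrite ?mul1mx.
Qed.

(** Evaluating at [linform c] the characteristic polynomial of [linform c] gives
    [0]; replacing its coefficients by their values at [w], which changes them
    by invariants vanishing at [w], gives the product on the left. *)
Lemma bump_linform c : exists (n : nat) (r : nat -> S),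
  (forall i, Ginvariant G (r i) /\ evalp (r i) w = 0) /\
  orbit_bump G c w * linform_at c w = \sum_(i < n) r i * linform c ^+ i.
Proof.
set l := linform c; set P0 := charp_at G l w.
exists (size (gelems G)).+1, (fun i => (P0`_i)%:MP - (charp G l)`_i); split.
  move=> i; split; last by rewrite evalpB evalpC evalp_charp subrr.
  by apply: GinvariantB; [exact: GinvariantC|exact: Ginvariant_charp].
under eq_bigr do rewrite mulrBl.
rewrite sumrB -(horner_coef_wide l) ?size_charp// charp_root subr0.
transitivity ((map_poly (@mpolyC 2 K) P0).[l]); last first.
  rewrite (@horner_coef_wide _ (size (gelems G)).+1); last first.
    by rewrite -(size_charp_at G l w) size_poly.
  by apply: eq_bigr => i _; rewrite coef_map.
have G1 : 1%:M \in gelems G by apply/mem_gelems; exact: gl2_1.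
rewrite /P0 /charp_at rmorph_prod horner_prod (bigD1_seq _ G1 (gelems_uniq G))/=.
rewrite mulrC mul1mx; congr (_ * _).
  by rewrite rmorphB /= map_polyX map_polyC hornerXsubC.
rewrite /orbit_bump big_seq_cond [RHS]big_seq_cond; apply: eq_big => g.
  by have [/mem_gelems/act_neq ->|//] := boolP (g \in _).
by move=> _; rewrite rmorphB /= map_polyX map_polyC hornerXsubC.
Qed.

(** By the previous lemma the product under the trace is a combination of
    products of two invariants vanishing at [w], which [D] kills. *)
Lemma derivation_order2 c c' F :
  D (Tr G (orbit_bump G c w * linform_at c w * (orbit_bump G c' w * linform_at c' w) * F)) = 0.
Proof.
have [n [r [rP ->]]] := bump_linform c; have [n' [r' [r'P ->]]] := bump_linform c'.
set l := linform c; set l' := linform c'.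
have -> : (\sum_(i < n) r i * l ^+ i) * (\sum_(i < n') r' i * l' ^+ i) * F =
   \sum_(i < n) \sum_(j < n') r i * (r' j * (l ^+ i * l' ^+ j * F)).
  rewrite !mulr_suml; apply: eq_bigr => i _.
  by rewrite mulr_sumr mulr_suml; apply: eq_bigr => j _; ring.
have TrS I (s : seq I) (H : I -> S) :
    Tr G (\sum_(i <- s) H i) = \sum_(i <- s) Tr G (H i).
  apply: (big_morph (Tr G)); first exact: TrD.
  by rewrite Tr_inv ?scaler0//; exact: Ginvariant0.
rewrite TrS derivation_sum => [|i _]; last exact: Ginvariant_Tr.
rewrite big1// => i _; rewrite TrS derivation_sum => [|j _]; last exact: Ginvariant_Tr.
rewrite big1// => j _; have [ri ri0] := rP i; have [rj rj0] := r'P j.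
rewrite Tr_invM// Tr_invM// DM//; last by apply: GinvariantM => //; exact: Ginvariant_Tr.
by rewrite ri0 evalpM rj0 !mul0r mulr0 addr0.
Qed.

End AtPoint.

Section AtPoint2.
Variable w : V.
Hypothesis free_w : free_point w.

Lemma evalp_Tr_bump c F : evalp (Tr G (orbit_bump G c w * F)) w = evalp (orbit_bump G c w) w * evalp F w.
Proof.
have G1 : 1%:M \in gelems G by apply/mem_gelems; exact: gl2_1.
rewrite evalp_Tr (bigD1_seq _ G1 (gelems_uniq G)) /= mul1mx evalpM big_seq_cond.
rewrite big1 ?addr0// => g /andP[/mem_gelems Gg].
by rewrite -(act_neq free_w Gg) => gw; rewrite evalpM bump_eq0// mul0r.
Qed.

(** The bump occurs twice so that the other points of the orbit contribute to
    order two only. *)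
Lemma dder_Tr_bump c F eta : evalp F w = 0 ->
  dder w eta (Tr G (orbit_bump G c w * (orbit_bump G c w * F))) =
  evalp (orbit_bump G c w) w ^+ 2 * dder w eta F.
Proof.
move=> F0; have G1 : 1%:M \in gelems G by apply/mem_gelems; exact: gl2_1.
rewrite dder_sum (bigD1_seq _ G1 (gelems_uniq G)) /= act1 !dderM evalpM F0.
rewrite big_seq_cond big1 => [|g /andP[/mem_gelems Gg]]; first ring.
rewrite -(act_neq free_w Gg) => gw.
rewrite (dder_comp _ _ (evalp_act g _)) dderM evalpM bump_eq0//; ring.
Qed.

(** The traces [f1], [f2] of bumps times linear forms are local coordinates at
    the orbit. The vector [eta] is chosen so that [D] and the derivative along
    [eta] agree on them; an invariant differs from a combination of [f1], [f2]
    by an invariant [h] vanishing to order two, and [derivation_order2] applies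
    to [h] times the trace of a product of bumps. *)
Lemma derivation_tangent D : derivation_at w D ->
  exists eta, forall f, Ginvariant G f -> D f = dder w eta f.
Proof.
move=> Dder; have [c _ sc] := separating G w [::].
have [c' + sc'] := separating G w [:: c]; rewrite inE eq_sym => cc'.
set s := orbit_bump G c w; set s' := orbit_bump G c' w.
have s0 : evalp s w != 0 by exact: bump_neq0.
have s'0 : evalp s' w != 0 by exact: bump_neq0.
set l := linform_at c w; set l' := linform_at c' w.
pose f1 := Tr G (s * (s * l)); pose f2 := Tr G (s * (s * l')).
have d1 eta : dder w eta f1 = evalp s w ^+ 2 * (eta ord0 ord0 + c * eta (lift ord0 ord0) ord0).
  by rewrite dder_Tr_bump ?linform_at0// dder_linform_at.
have d2 eta : dder w eta f2 = evalp s w ^+ 2 * (eta ord0 ord0 + c' * eta (lift ord0 ord0) ord0).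
  by rewrite dder_Tr_bump ?linform_at0// dder_linform_at.
have if1 : Ginvariant G f1 by exact: Ginvariant_Tr.
have if2 : Ginvariant G f2 by exact: Ginvariant_Tr.
have f10 : evalp f1 w = 0 by rewrite evalp_Tr_bump evalpM linform_at0 !mulr0.
have f20 : evalp f2 w = 0 by rewrite evalp_Tr_bump evalpM linform_at0 !mulr0.
have cc0 : c - c' != 0 by rewrite subr_eq0.
pose a := D f1 / evalp s w ^+ 2; pose b := D f2 / evalp s w ^+ 2.
pose eta : V := \col_i (if i == ord0 then (c * b - c' * a) / (c - c')
                       else (a - b) / (c - c')).
exists eta.
(* [E] measures the failure of the claim and is itself a derivation. *)
pose E f := D f - dder w eta f.
have Eder : derivation_at w E.
  have [DC DD DM] := Dder; split=> [k|f h fi hi|f h fi hi]; rewrite /E.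
  - by rewrite DC dderC subrr.
  - by rewrite DD// dderD; ring.
  - by rewrite DM// dderM; ring.
have [EC ED EM] := Eder.
have Ef1 : E f1 = 0.
  rewrite /E d1 !mxE /=.
  have -> : (c * b - c' * a) / (c - c') + c * ((a - b) / (c - c')) = a by field.
  by rewrite /a mulrC divfK ?subrr// expf_neq0.
have Ef2 : E f2 = 0.
  rewrite /E d2 !mxE /=.
  have -> : (c * b - c' * a) / (c - c') + c' * ((a - b) / (c - c')) = b by field.
  by rewrite /b mulrC divfK ?subrr// expf_neq0.
move=> f fi; apply/eqP; rewrite -subr_eq0 -/(E f); apply/eqP.
have [A [B fE]] := hadamard w f cc'.
pose al := evalp A w / evalp s w ^+ 2; pose be := evalp B w / evalp s w ^+ 2.
pose h := f - ((evalp f w)%:MP + (al%:MP * f1 + be%:MP * f2)).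
have ic (k : K) : Ginvariant G k%:MP by exact: GinvariantC.
have i2 : Ginvariant G (al%:MP * f1 + be%:MP * f2) by apply: GinvariantD; exact: GinvariantM.
have ih : Ginvariant G h by apply: GinvariantB => //; exact: GinvariantD.
have h0 : evalp h w = 0 by rewrite /h evalpB !evalpD !evalpM f10 f20 !evalpC; ring.
have dh xi : dder w xi h = 0.
  rewrite /h dderB !dderD !dderM !dderC d1 d2 !evalpC f10 f20 {1}fE.
  rewrite !dderD !dderM !dder_linform_at !linform_at0 dderC /al /be; field.
  by rewrite s0.
have Eh : E h = 0.
  have [A1 [A2 [A3 hE]]] := hadamard2 cc' h0 dh.
  (* Each quadratic term of [h] finds in [e] the two bumps that
     [derivation_order2] asks for. *)
  pose e := s * (s * (s' * s')).
  have Eeh : E (h * Tr G e) = 0.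
    rewrite -(Tr_invM _ ih).
    have -> : h * e = s * l * (s * l) * (s' * s' * A1) +
      (s * l * (s' * l') * (s * s' * A2) + s' * l' * (s' * l') * (s * s * A3)).
      by rewrite {1}hE /e -/l -/l'; ring.
    rewrite !TrD !ED; try exact: Ginvariant_Tr; last by apply: GinvariantD; exact: Ginvariant_Tr.
    by rewrite !derivation_order2 ?addr0.
  have := Eeh; rewrite EM//; last exact: Ginvariant_Tr.
  rewrite h0 mul0r addr0 evalp_Tr_bump !evalpM => /eqP.
  by rewrite mulf_eq0 !mulf_eq0 (negPf s0) (negPf s'0) /= orbF => /eqP.
transitivity (E (h + ((evalp f w)%:MP + (al%:MP * f1 + be%:MP * f2)))).
  by rewrite /h subrK.
rewrite ED//; last exact: GinvariantD.
rewrite Eh add0r ED// ED ?EM//; try exact: GinvariantM.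
by rewrite !EC Ef1 Ef2; ring.
Qed.

End AtPoint2.
End Smooth.

(** * Dual numbers *)

Definition dual (K : comNzRingType) : Type := (K * K)%type.

Section Dual.
Variable K : comNzRingType.

HB.instance Definition _ := GRing.Zmodule.copy (dual K) (K * K)%type.

Definition dual_mul (x y : dual K) : dual K := (x.1 * y.1, x.1 * y.2 + x.2 * y.1).

Lemma dual_mulA : associative dual_mul.
Proof. by move=> [a b] [c d] [e f]; congr pair => /=; ring. Qed.
Lemma dual_mulC : commutative dual_mul.
Proof. by move=> [a b] [c d]; congr pair => /=; ring. Qed.
Lemma dual_mul1 : left_id ((1, 0) : dual K) dual_mul.
Proof. by move=> [a b]; congr pair => /=; ring. Qed.
Lemma dual_mulDl : left_distributive dual_mul +%R.
Proof. by move=> [a b] [c d] [e f]; congr pair => /=; ring. Qed.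

HB.instance Definition _ := GRing.Zmodule_isComPzRing.Build (dual K)
  dual_mulA dual_mulC dual_mul1 dual_mulDl.

Definition dual_fst (x : dual K) : K := x.1.

Lemma dual_fst_is_zmod_morphism : zmod_morphism dual_fst.
Proof. by []. Qed.
Lemma dual_fst_is_monoid_morphism : monoid_morphism dual_fst.
Proof. by []. Qed.

HB.instance Definition _ := GRing.isZmodMorphism.Build (dual K) K dual_fst
  dual_fst_is_zmod_morphism.
HB.instance Definition _ := GRing.isMonoidMorphism.Build (dual K) K dual_fst
  dual_fst_is_monoid_morphism.

Lemma dual_fst_square_zero (x y : dual K) :
  dual_fst x = 0 -> dual_fst y = 0 -> x * y = 0.
Proof.
rewrite /dual_fst => x0 y0.
by rewrite /GRing.mul /= /dual_mul x0 y0 !mul0r mulr0 addr0.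
Qed.

End Dual.

(** * The induced endomorphism of the ring of invariants *)

Lemma regular_subspace (K : fieldType) (T : funspace K) (Z : set T)
    (z : subfunspace Z) (f : subfunspace Z -> K) : regular_at z f ->
  exists2 F : T -> K, regular_at (val z) F &
    exists2 M : set T, nbhs (val z) M & forall w : subfunspace Z, M (val w) -> f w = F (val w).
Proof.
move=> [F Fr near_z]; exists F => //.
have [A [oA Az AF]] : exists A : set T,
    [/\ open A, A (val z) & forall w : subfunspace Z, A (val w) -> f w = F (val w)].
  have : nbhs z [set w | f w = F (val w)] by exact: near_z.
  rewrite nbhsE => -[B [[A oA AB] Bz] BF]; exists A; split=> //.
    by rewrite -AB in Bz.
  by move=> w Aw; apply: BF; rewrite -AB.
by exists A => //; exact: (open_nbhs_nbhs (conj oA Az)).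
Qed.

Section InducedEndomorphism.
Variables (K : numClosedFieldType) (G : finite_subgroup_GL2 K).
Variable phi : morphism (quotA2 G) (quotA2 G).
Local Notation S := {mpoly K[2]}.
Local Notation V := 'cV[K]_2.
Local Notation A2 := (affine_space K 2).
Local Notation pi v := (quotient_pi (orbit_equiv G) (v : V) : quotA2 G).
Implicit Types (p q f h F : S) (v w : V).

(** A set-theoretic lift of [phi] to the plane, which allows to evaluate pullbacks
    of invariants; it has no regularity, but any lift takes the same values under
    invariants. *)
Definition zeta v : V := lift_pt (phi (pi v)).

Lemma pi_zeta v : pi (zeta v) = phi (pi v).
Proof. exact: pi_lift. Qed.

Lemma pullback_invariant f : Ginvariant G f ->
  exists p, forall v, evalp p v = evalp f (zeta v).
Proof.
move=> fi; pose fbar (x : quotA2 G) := evalp f (lift_pt x).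
have fr (x : quotA2 G) : regular_at x fbar.
  rewrite -(pi_lift x); apply/regular_quotP; exists f, 1; split=> //.
  - exact: Ginvariant1.
  - by rewrite evalp1 oner_neq0.
  - by move=> v; rewrite evalp1 mul1r; apply: (Ginvariant_pi fi); exact: pi_lift.
have := @regular_plane_poly K (fun v : A2 => fbar (phi (pi v))).
case=> [v|p pE]; last by exists p => v; rewrite -pE.
exact: (nbhs_singleton (mor_regular (fr (phi (pi v)))) v erefl).
Qed.

(** The endomorphism [phi^*] of the invariants, extended by an arbitrary choice
    to all polynomials. *)
Definition phis f : S := xget 0 [set p | forall v, evalp p v = evalp f (zeta v)].

Lemma evalp_phis f v : Ginvariant G f -> evalp (phis f) v = evalp f (zeta v).
Proof.
move=> /pullback_invariant[p pE]; rewrite /phis.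
by case: xgetP => [q _ ->//|/(_ p)]; case.
Qed.

Lemma Ginvariant_phis f : Ginvariant G f -> Ginvariant G (phis f).
Proof.
move=> fi g Gg v; rewrite !evalp_phis//; apply: (Ginvariant_pi fi).
by rewrite !pi_zeta pi_act.
Qed.

Lemma phisE f p : Ginvariant G f -> (forall v, evalp p v = evalp f (zeta v)) -> phis f = p.
Proof. by move=> fi pE; apply: evalp_inj => v; rewrite evalp_phis. Qed.

Lemma phisC c : phis c%:MP = c%:MP.
Proof. by apply: phisE => [|v]; [exact: GinvariantC|rewrite !evalpC]. Qed.
Lemma phisD f h : Ginvariant G f -> Ginvariant G h -> phis (f + h) = phis f + phis h.
Proof.
move=> fi hi; apply: phisE => [|v]; first exact: GinvariantD.
by rewrite !evalpD !evalp_phis.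
Qed.
Lemma phisM f h : Ginvariant G f -> Ginvariant G h -> phis (f * h) = phis f * phis h.
Proof.
move=> fi hi; apply: phisE => [|v]; first exact: GinvariantM.
by rewrite !evalpM !evalp_phis.
Qed.
Lemma phis_derivation v xi : derivation_at G (zeta v) (fun f => dder v xi (phis f)).
Proof.
split=> [c|f h fi hi|f h fi hi]; first by rewrite phisC dderC.
  by rewrite phisD// dderD.
by rewrite phisM// dderM !evalp_phis.
Qed.

End InducedEndomorphism.

(** * Tangent vectors of the quotient and unramifiedness *)

Section Tangent.
Variables (K : numClosedFieldType) (G : finite_subgroup_GL2 K).
Local Notation S := {mpoly K[2]}.
Local Notation V := 'cV[K]_2.
Local Notation X := (quotA2 G).
Local Notation Xo := (quotA2o G).
Local Notation pi v := (quotient_pi (orbit_equiv G) (v : V) : quotA2 G).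
Implicit Types (p q f h F : S) (v w : V).

Lemma pi_neq_P0 v : v != 0 -> pi v <> P0 G.
Proof.
move=> v0 /esym/piP[g Gg vg]; move: v0; rewrite vg.
by rewrite mulmx0 eqxx.
Qed.

(** Sections of an open subset of the punctured quotient are, near the orbit of
    [v], quotients of invariants. The identity is required on all of [U], not
    just near that orbit, so that derivatives of [b] can be computed from [p] and
    [q] by polynomial identities. *)
Definition fraction (U : set Xo) (b : subfunspace U -> K) v p q :=
  [/\ Ginvariant G p, Ginvariant G q, evalp q v != 0 & forall z : subfunspace U,
    evalp q (lift_pt (val (val z))) * b z = evalp p (lift_pt (val (val z)))].

Lemma fraction_exists (U : set Xo) (u : subfunspace U) (b : subfunspace U -> K) v :
  val (val u) = pi v -> regular_at u b -> exists p q, fraction b v p q.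
Proof.
move=> uv /regular_subspace[F /regular_subspace[H Hr [M2 M2n M2E]] [M Mn ME]].
have : nbhs (val u) [set y : Xo | M y /\ M2 (val y)].
  by apply: filterI => //; exact: (@initial_continuous _ _ (@set_val _ _) (val u) M2).
rewrite nbhsE => -[B [[A oA AB] Bu] BM].
have Av : A (pi v) by rewrite -uv; rewrite -AB in Bu.
have : nbhs (pi v) A by exact: (open_nbhs_nbhs (conj oA Av)).
case/quot_nbhsP => r [ri rv rA].
move: Hr; rewrite uv => /regular_quotP[p [q [ip iq qv qH]]].
exists (r * p), (r * q); split; [exact: GinvariantM|exact: GinvariantM|by rewrite evalpM mulf_neq0|].
move=> z; rewrite !evalpM -mulrA; set y := lift_pt _.
have [->|ry] := eqVneq (evalp r y) 0; first by rewrite !mul0r.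
congr (_ * _).
have yz : pi y = val (val z) by exact: pi_lift.
have [Mz M2z] : M (val z) /\ M2 (val (val z)).
  by apply: BM; rewrite -AB /= -[set_val _]yz; exact: rA.
by rewrite ME// M2E// -yz qH.
Qed.

Lemma open_invariant (U : set Xo) (u : subfunspace U) v : open U -> val (val u) = pi v ->
  exists r, [/\ Ginvariant G r, evalp r v != 0 & forall y, y != 0 -> evalp r y != 0 ->
    exists z : subfunspace U, val (val z) = pi y].
Proof.
move=> [A oA AU] uv.
have Av : A (pi v).
  rewrite -uv; have := valP u; rewrite inE => Uu.
  by have : (set_val @^-1` A) (val u) by rewrite AU.
have : nbhs (pi v) A by exact: (open_nbhs_nbhs (conj oA Av)).
case/quot_nbhsP => r [ri rv rA]; exists r; split=> // y y0 ry.
have yP : (~` [set P0 G]) (pi y) by exact: pi_neq_P0.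
pose z : Xo := SigSub (mem_set yP).
have Uz : U z by rewrite -AU; exact: rA.
by exists (SigSub (mem_set Uz)).
Qed.

(** The two polynomials agree over [U], which contains a nonempty principal open
    set of the plane minus the origin. *)
Lemma fraction_cross (U : set Xo) (u : subfunspace U) (b : subfunspace U -> K) v p q p' q' :
  open U -> val (val u) = pi v -> fraction b v p q -> fraction b v p' q' ->
  p * q' = p' * q.
Proof.
move=> oU uv [ip iq qv qb] [ip' iq' q'v q'b].
have [r [ri rv rU]] := open_invariant oU uv.
apply/eqP; rewrite -subr_eq0.
have r0 : r != 0 by apply: contraNneq rv => ->; rewrite evalp0.
apply/negPn/negP => d0; have [y y0] := evalp_neq0 (mulf_neq0 r0 d0).
rewrite evalpM mulf_eq0 negb_or => /andP[/(rU _ y0)[z zy]].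
apply/negP; rewrite negbK evalpB !evalpM subr_eq0.
have E f : Ginvariant G f -> evalp f y = evalp f (lift_pt (val (val z))).
  by move=> fi; apply: (Ginvariant_pi fi); rewrite -zy pi_lift.
rewrite !E// -qb -q'b; apply/eqP; ring.
Qed.

Section TangentHom.
Variables (U : set Xo) (u : subfunspace U) (v xi : V).
Hypotheses (oU : open U) (uv : val (val u) = pi v).
Local Notation O := (sections (subfunspace U)).

Lemma section_fraction (b : O) : exists p q, fraction (section_fun b) v p q.
Proof.
apply: (fraction_exists uv); have /asboolP := section_regular b; exact.
Qed.

Definition num (b : O) : S := projT1 (cid (section_fraction b)).
Definition den (b : O) : S := projT1 (cid (projT2 (cid (section_fraction b)))).
Lemma num_denP b : fraction (section_fun b) v (num b) (den b).
Proof. exact: (projT2 (cid (projT2 (cid (section_fraction b))))). Qed.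

(** The ring homomorphism to the dual numbers given by the value and the
    derivative along [xi] at [v], through the quotient rule. *)
Definition tangent_hom (b : O) : dual K :=
  (evalp (num b) v / evalp (den b) v,
   (dder v xi (num b) * evalp (den b) v - evalp (num b) v * dder v xi (den b))
     / evalp (den b) v ^+ 2).

Lemma tangent_homE (b : O) p q : fraction (section_fun b) v p q -> tangent_hom b =
  (evalp p v / evalp q v,
   (dder v xi p * evalp q v - evalp p v * dder v xi q) / evalp q v ^+ 2).
Proof.
move=> pq; have pq' := num_denP b.
have E := fraction_cross oU uv pq' pq; rewrite /tangent_hom.
case: pq pq' => [_ _ q0 _] [_ _ q'0 _].
set P := num b in E *; set Q := den b in E q'0 *.
have /= Ev := congr1 (fun F => evalp F v) E; rewrite !evalpM in Ev.
have /= Ed := congr1 (dder v xi) E; rewrite !dderM in Ed.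
have EP : evalp P v = evalp p v * evalp Q v / evalp q v by rewrite -Ev mulfK.
have EdP : dder v xi P = (dder v xi p * evalp Q v + evalp p v * dder v xi Q
    - evalp P v * dder v xi q) / evalp q v by rewrite -Ed addrK mulfK.
congr pair; first by rewrite EP; field; rewrite q0 q'0.
by rewrite EdP EP; field; rewrite q0 q'0.
Qed.

Lemma tangent_hom_is_zmod_morphism : zmod_morphism tangent_hom.
Proof.
move=> a b; have [ia ja qa aE] := num_denP a; have [ib jb qb bE] := num_denP b.
rewrite (@tangent_homE (a - b) (num a * den b - num b * den a) (den a * den b)).
  rewrite /tangent_hom !dderB !evalpB !evalpM !dderM.
  by congr pair => /=; field; rewrite qa qb.
split; [by apply: GinvariantB; exact: GinvariantM|exact: GinvariantM|by rewrite evalpM mulf_neq0|].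
move=> z; rewrite evalpB !evalpM -aE -bE.
by rewrite (_ : section_fun (a - b) z = section_fun a z - section_fun b z)//; ring.
Qed.

Lemma tangent_hom_is_monoid_morphism : monoid_morphism tangent_hom.
Proof.
split=> [|a b].
  rewrite (@tangent_homE 1 1 1).
    by rewrite !evalp1 (dderC _ _ 1) !mul0r !mulr0 subrr mul0r divr1.
  split; [exact: Ginvariant1|exact: Ginvariant1|by rewrite evalp1 oner_neq0|].
  by move=> z; rewrite evalp1 mul1r.
have [ia ja qa aE] := num_denP a; have [ib jb qb bE] := num_denP b.
rewrite (@tangent_homE (a * b) (num a * num b) (den a * den b)).
  rewrite /tangent_hom !evalpM !dderM.
  by congr pair => /=; field; rewrite qa qb.
split; [exact: GinvariantM|exact: GinvariantM|by rewrite evalpM mulf_neq0|].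
move=> z; rewrite !evalpM -aE -bE.
by rewrite (_ : section_fun (a * b) z = section_fun a z * section_fun b z)//; ring.
Qed.

HB.instance Definition _ := GRing.isZmodMorphism.Build O (dual K) tangent_hom
  tangent_hom_is_zmod_morphism.
HB.instance Definition _ := GRing.isMonoidMorphism.Build O (dual K) tangent_hom
  tangent_hom_is_monoid_morphism.

Definition tangent_rmorphism : {rmorphism O -> dual K} := tangent_hom.

End TangentHom.

End Tangent.

Section Unramified.
Variables (K : numClosedFieldType) (G : finite_subgroup_GL2 K).
Variables (phi : morphism (quotA2 G) (quotA2 G)) (phio : morphism (quotA2o G) (quotA2o G)).
Hypotheses (phi_phio : restricts_to phi phio) (phio_etale : etale phio).
Hypothesis G_small : small G.
Local Notation S := {mpoly K[2]}.
Local Notation V := 'cV[K]_2.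
Local Notation pi v := (quotient_pi (orbit_equiv G) (v : V) : quotA2 G).
Local Notation zeta := (zeta phi).
Local Notation phis := (phis phi).
Implicit Types (p q f h F : S) (v w : V).

Lemma zeta_neq0 v : v != 0 -> zeta v != 0.
Proof.
move=> v0; apply/eqP => z0.
have yP : (~` [set P0 G]) (pi v) by exact: pi_neq_P0.
have := valP (phio (SigSub (mem_set yP))); rewrite inE; apply.
by rewrite phi_phio /= -pi_zeta z0.
Qed.

(** The traces of [dder_Tr_bump] are invariants whose differentials at [v] are
    multiples of two independent linear forms. *)
Lemma tangent_separated v xi : free_point G v ->
  (forall f, Ginvariant G f -> dder v xi f = 0) -> xi = 0.
Proof.
move=> fv H.
have lin0 c : separates G c v -> xi ord0 ord0 + c * xi (lift ord0 ord0) ord0 = 0.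
  move=> sc; have := H _ (Ginvariant_Tr (orbit_bump G c v * (orbit_bump G c v * linform_at c v))).
  rewrite dder_Tr_bump ?linform_at0// dder_linform_at => /eqP.
  by rewrite mulf_eq0 expf_eq0/= (negPf (bump_neq0 sc)) => /eqP.
have [c _ /lin0 E] := separating G v [::].
have [c' + /lin0 E'] := separating G v [:: c]; rewrite inE -subr_eq0 => cc'.
have x1 : xi (lift ord0 ord0) ord0 = 0.
  apply: (mulfI cc'); rewrite mulr0 -[RHS](subrr 0) -{1}E' -E; ring.
by apply/col2P; rewrite mxE// -[RHS]E x1 mulr0 addr0.
Qed.

(** A tangent vector killed by [phi] gives two homomorphisms to the dual numbers
    from the ring of a neighbourhood, lifting the same evaluation and agreeing
    on the functions that come from the target. *)
Lemma etale_unramified v xi : v != 0 ->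
  (forall f, Ginvariant G f -> dder v xi (phis f) = 0) -> xi = 0.
Proof.
move=> v0 xi0; apply: (tangent_separated (small_free G_small v0)) => f fi.
have yP : (~` [set P0 G]) (pi v) by exact: pi_neq_P0.
have [U [W [g [[oU Ux oW Wx] [_ _ gE get]]]]] := phio_etale (SigSub (mem_set yP)).
pose u : subfunspace U := SigSub (mem_set Ux).
have uv : val (val u) = pi v by [].
pose T eta := tangent_rmorphism eta oU uv.
have TE eta (b : sections (subfunspace U)) p q : fraction (section_fun b) v p q ->
   T eta b = (evalp p v / evalp q v,
   (dder v eta p * evalp q v - evalp p v * dder v eta q) / evalp q v ^+ 2).
  exact: tangent_homE.
have T0 (b : sections (subfunspace U)) p q : fraction (section_fun b) v p q ->
   T 0 b = (evalp p v / evalp q v, 0).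
  move=> /TE ->; congr pair.
  by rewrite !dderE !big1 ?mul0r ?mulr0 ?subr0 ?mul0r// => i _; rewrite mxE mul0r.
have pullT (a : sections (subfunspace W)) : T xi (pullback g a) = T 0 (pullback g a).
  have gu : val (val (g u)) = pi (zeta v) by rewrite pi_zeta gE phi_phio.
  have [p [q [ip iq qv qa]]] := section_fraction gu a.
  have pq : fraction (section_fun (pullback g a)) v (phis p) (phis q).
    split; [exact: Ginvariant_phis|exact: Ginvariant_phis|by rewrite evalp_phis|].
    move=> z; rewrite !evalp_phis//.
    have E h : Ginvariant G h -> evalp h (zeta (lift_pt (val (val z)))) =
                           evalp h (lift_pt (val (val (g z)))).
      by move=> hi; apply: (Ginvariant_pi hi); rewrite pi_zeta !pi_lift gE phi_phio.
    by rewrite !E//; exact: qa.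
  by rewrite (TE _ _ _ _ pq) (T0 _ _ _ pq) !xi0// mul0r mulr0 subrr mul0r.
have [w [_ _ wuniq]] := get (dual K) K (@dual_fst K) (T 0 \o pullback g)
  (@dual_fst K \o T 0) (fun y => ex_intro _ (y, 0) erefl)
  (@dual_fst_square_zero K) (fun a => erefl).
(* Both [T 0] and [T xi] are liftings, hence they agree. *)
have E0 := wuniq (T 0) (fun=> erefl) (fun=> erefl).
have Exi : T xi =1 w.
  apply: wuniq => [a|b]; first exact: pullT.
  have [p [q pq]] := section_fraction uv b.
  change (dual_fst (T xi b) = dual_fst (T 0 b)).
  by rewrite (TE _ _ _ _ pq) (T0 _ _ _ pq).
have [b bE] : exists b : sections (subfunspace U),
    forall z, section_fun b z = evalp f (lift_pt (val (val z))).
  have br : (fun z : subfunspace U => evalp f (lift_pt (val (val z)))) \in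
      @global_regular K (subfunspace U).
    apply/asboolP => z; exists (fun y : quotA2o G => evalp f (lift_pt (val y))).
      exists (fun x : quotA2 G => evalp f (lift_pt x)).
        rewrite -[val (val z)]pi_lift; apply/regular_quotP; exists f, 1; split=> //.
        - exact: Ginvariant1.
        - by rewrite evalp1 oner_neq0.
        - by move=> y; rewrite evalp1 mul1r; apply: (Ginvariant_pi fi); exact: pi_lift.
      by apply: (@filterE _ (nbhs (val z))).
    by apply: (@filterE _ (nbhs z)).
  by exists (GlobalSection br).
have fb : fraction (section_fun b) v f 1.
  split; [by []|exact: Ginvariant1|by rewrite evalp1 oner_neq0|].
  by move=> z; rewrite evalp1 mul1r bE.
have := Exi b; rewrite -E0 (TE _ _ _ _ fb) (T0 _ _ _ fb) => -[].
by rewrite evalp1 (dderC _ _ 1) mulr0 subr0 expr1n divr1 mulr1.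
Qed.

Lemma det2 (a b c d : K) : a * d - b * c = 0 ->
  exists x y, [/\ (x != 0) || (y != 0), x * a + y * c = 0 & x * b + y * d = 0].
Proof.
move=> D; have [/orP cd|] := boolP ((c != 0) || (a != 0)).
  exists c, (- a); rewrite oppr_eq0; split; [by apply/orP|ring|].
  by rewrite -[RHS]oppr0 -D; ring.
rewrite negb_or !negbK => /andP[/eqP c0 /eqP a0].
have [bd|] := boolP ((d != 0) || (b != 0)).
  by exists d, (- b); rewrite oppr_eq0 c0 a0; split; [by []|ring|ring].
rewrite negb_or !negbK => /andP[/eqP -> /eqP ->]; exists 1, 0.
by rewrite oner_neq0 c0 a0; split; [by []|ring|ring].
Qed.

Definition jac f h : S :=
  f^`M(ord0) * h^`M(lift ord0 ord0) - f^`M(lift ord0 ord0) * h^`M(ord0).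

Lemma dder2 v (xi : V) f : dder v xi f = xi ord0 ord0 * evalp f^`M(ord0) v +
  xi (lift ord0 ord0) ord0 * evalp f^`M(lift ord0 ord0) v.
Proof. by rewrite dderE big_ord_recl big_ord1. Qed.

(** On differentials of invariants, [phi] acts at [v] through a linear map of
    tangent spaces, whose determinant is the factor. *)
Lemma jac_phis v : v != 0 -> exists2 d : K, d != 0 & forall f h,
  Ginvariant G f -> Ginvariant G h -> evalp (jac (phis f) (phis h)) v = d * evalp (jac f h) (zeta v).
Proof.
move=> v0; have fz := small_free G_small (zeta_neq0 v0).
pose e (i : 'I_2) : V := delta_mx i ord0.
have [eta0 E0] := derivation_tangent fz (phis_derivation phi v (e ord0)).
have [eta1 E1] := derivation_tangent fz (phis_derivation phi v (e (lift ord0 ord0))).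
pose d := eta0 ord0 ord0 * eta1 (lift ord0 ord0) ord0
        - eta0 (lift ord0 ord0) ord0 * eta1 ord0 ord0.
have d1 f : Ginvariant G f -> evalp (phis f)^`M(ord0) v = dder (zeta v) eta0 f.
  by move=> fi; rewrite -E0// dder2 !mxE /= mul1r mul0r addr0.
have d2 f : Ginvariant G f -> evalp (phis f)^`M(lift ord0 ord0) v = dder (zeta v) eta1 f.
  by move=> fi; rewrite -E1// dder2 !mxE /= mul1r mul0r add0r.
exists d; last first.
  move=> f h fi hi; rewrite /jac !evalpB !evalpM !d1// !d2// !dder2 /d; ring.
apply/eqP => /det2[x [y [xy e1 e2]]].
have : x *: e ord0 + y *: e (lift ord0 ord0) = 0.
  apply: (etale_unramified v0) => f fi.
  rewrite dder_linear -[y *: _]addr0 dder_linear E0// E1//.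
  rewrite [X in _ + (_ + X)]dderE big1 => [|i _]; last by rewrite mxE mul0r.
  rewrite addr0 !dder2.
  transitivity ((x * eta0 ord0 ord0 + y * eta1 ord0 ord0) * evalp f^`M(ord0) (zeta v) +
   (x * eta0 (lift ord0 ord0) ord0 + y * eta1 (lift ord0 ord0) ord0)
     * evalp f^`M(lift ord0 ord0) (zeta v)); first ring.
  by rewrite e1 e2 !mul0r addr0.
move=> E; move: xy.
have := congr1 (fun u : V => u ord0 ord0) E; rewrite !mxE /= mulr1 mulr0 addr0 => ->.
have := congr1 (fun u : V => u (lift ord0 ord0) ord0) E.
by rewrite !mxE /= mulr1 mulr0 add0r => ->; rewrite eqxx.
Qed.

(** The invariants of [dder_Tr_bump] for two linear forms. *)
Lemma jac_neq0 w : w != 0 -> exists f h,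
  [/\ Ginvariant G f, Ginvariant G h & evalp (jac f h) w != 0].
Proof.
move=> w0; have fw := small_free G_small w0.
have [c _ sc] := separating G w [::].
have [c' + sc'] := separating G w [:: c]; rewrite inE => cc'.
pose F k := Tr G (orbit_bump G c w * (orbit_bump G c w * linform_at k w)).
have FE k xi : dder w xi (F k) = evalp (orbit_bump G c w) w ^+ 2 *
    (xi ord0 ord0 + k * xi (lift ord0 ord0) ord0).
  by rewrite dder_Tr_bump ?linform_at0// dder_linform_at.
exists (F c), (F c'); split; [exact: Ginvariant_Tr|exact: Ginvariant_Tr|].
have P0 k : evalp (F k)^`M(ord0) w = evalp (orbit_bump G c w) w ^+ 2.
  rewrite -[RHS]mulr1 -[X in _ = _ * X](_ : (delta_mx ord0 ord0 : V) ord0 ord0 +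
     k * (delta_mx ord0 ord0 : V) (lift ord0 ord0) ord0 = 1).
    by rewrite -FE dder2 !mxE /= mul1r mul0r addr0.
  by rewrite !mxE /= mulr0 addr0.
have P1 k : evalp (F k)^`M(lift ord0 ord0) w = evalp (orbit_bump G c w) w ^+ 2 * k.
  rewrite -[X in _ = _ * X](_ : (delta_mx (lift ord0 ord0) ord0 : V) ord0 ord0 +
     k * (delta_mx (lift ord0 ord0) ord0 : V) (lift ord0 ord0) ord0 = k).
    by rewrite -FE dder2 !mxE /= mul1r mul0r add0r.
  by rewrite !mxE /= mulr1 add0r.
rewrite /jac evalpB !evalpM !P0 !P1.
set s := evalp (orbit_bump _ _ _) _.
have -> : s ^+ 2 * (s ^+ 2 * c') - s ^+ 2 * c * s ^+ 2 = s ^+ 4 * (c' - c) by ring.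
by rewrite mulf_neq0 ?expf_neq0 ?bump_neq0// subr_eq0.
Qed.

(** The trace of [p] times a bump at [zeta v] is an invariant with zero pullback,
    so its differential at [zeta v], a multiple of that of [p], is zero by
    [jac_phis]. *)
Lemma dder_image v xi p : v != 0 ->
  (forall g y, G g -> y != 0 -> evalp p (g *m zeta y) = 0) ->
  dder (zeta v) xi p = 0.
Proof.
move=> v0 pZ; have fz := small_free G_small (zeta_neq0 v0).
have [c _ sc] := separating G (zeta v) [::].
set s := orbit_bump G c (zeta v).
have s0 : evalp s (zeta v) != 0 by exact: bump_neq0.
set f := Tr G (s * (s * p)); have fi : Ginvariant G f by exact: Ginvariant_Tr.
have f0 : phis f = 0.
  apply/eqP/negPn/negP => /evalp_neq0[y y0]; rewrite evalp_phis// evalp_Tr.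
  by rewrite big1_seq ?eqxx// => g /andP[_ /mem_gelems Gg]; rewrite !evalpM pZ ?mulr0.
have [d d0 dE] := jac_phis v0.
have jac0 h : Ginvariant G h -> evalp (jac f h) (zeta v) = 0.
  move=> hi; apply: (mulfI d0); rewrite -dE// mulr0 f0 /jac.
  by rewrite !mderiv0 !mul0r subrr evalp0.
have [h1 [h2 [i1 i2 J]]] := jac_neq0 (zeta_neq0 v0).
have J1 := jac0 _ i1; have J2 := jac0 _ i2.
apply: (mulfI (expf_neq0 2 s0)); rewrite mulr0 -dder_Tr_bump//; last first.
  by rewrite -[zeta v]mul1mx pZ//; exact: gl2_1.
apply: (mulfI J); rewrite mulr0 -/f dder2; move: J1 J2; rewrite /jac !evalpB !evalpM.
set a := evalp f^`M(ord0) _; set b := evalp f^`M(lift _ _) _ => J1 J2.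
set h1x := evalp h1^`M(ord0) _ in J1 *.
set h1y := evalp h1^`M(lift _ _) _ in J1 *.
set h2x := evalp h2^`M(ord0) _ in J2 *.
set h2y := evalp h2^`M(lift _ _) _ in J2 *.
set x := xi _ _; set y := xi _ _.
transitivity ((x * h1x + y * h1y) * (a * h2y - b * h2x)
   - (x * h2x + y * h2y) * (a * h1y - b * h1x)); first ring.
by rewrite J1 J2; ring.
Qed.

Lemma msize_mderiv n i p : (msize p <= n.+1)%N -> (msize p^`M(i) <= n)%N.
Proof.
move=> pn; rewrite msizeE; apply/bigmax_leqP_seq => m + _.
rewrite mcoeff_msupp mcoeff_mderiv => mp.
have : (m + U_(i))%MM \in msupp p.
  by rewrite mcoeff_msupp; apply: contraNneq mp => ->; rewrite mul0rn.
by move/msize_mdeg_lt; rewrite mdegD mdeg1 addn1 => /leq_trans/(_ pn).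
Qed.

(** The ideal of the points lying over the image of [phi] is stable under
    partial derivatives, since [phi] is a submersion; a nonzero ideal with that
    property contains a nonzero constant. *)
Lemma image_dense p :
  (forall g y, G g -> y != 0 -> evalp p (g *m zeta y) = 0) -> p = 0.
Proof.
have [n] := ubnP (msize p); elim: n p => // n IH p; rewrite ltnS => pn pZ.
have dp i : p^`M(i) = 0.
  case: n IH pn => [|n] IH pn.
    move: pn; rewrite leqn0 msize_poly_eq0 => /eqP ->; exact: mderiv0.
  apply: IH => [|g y Gg y0]; first exact: msize_mderiv.
  have <- : dder (g *m zeta y) (delta_mx i ord0) p = evalp p^`M(i) (g *m zeta y).
    rewrite dderE (bigD1 i)//= mxE !eqxx mul1r big1 ?addr0// => j ji.
    by rewrite mxE (negPf ji) mul0r.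
  rewrite -[delta_mx i ord0](mulKVmx (gl2_unit Gg)).
  rewrite -(dder_comp _ _ (evalp_act g p)); apply: dder_image => // h z Gh z0.
  by rewrite evalp_act mulmxA pZ//; exact: gl2_mul.
have pC : p = (p@_0)%:MP.
  apply/mpolyP => m; rewrite mcoeffC; have [->|m0] := eqVneq m 0%MM.
    by rewrite mulr1.
  rewrite mulr0; have [i mi] : exists i, m i != 0%N.
    apply: contrapT => H; case/eqP: m0; apply/mnmP => i; rewrite mnm0E.
    by apply/eqP/negPn/negP => mi; apply: H; exists i.
  have := congr1 (fun q => q@_(m - U_(i))) (dp i).
  rewrite mcoeff0 mcoeff_mderiv submK ?lep1mP// => /eqP.
  by rewrite -mulr_natr mulf_eq0 pnatr_eq0 orbF => /eqP.
have v0 : (const_mx 1 : V) != 0.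
  by apply/eqP => /colP/(_ ord0)/eqP; rewrite !mxE oner_eq0.
have := pZ _ _ (gl2_1 G) v0.
by rewrite pC evalpC => ->; rewrite mpolyC0.
Qed.

Lemma phis_inj f : Ginvariant G f -> phis f = 0 -> f = 0.
Proof.
move=> fi f0; apply: image_dense => g y Gg y0.
by rewrite fi// -evalp_phis// f0 evalp0.
Qed.

End Unramified.

(** * Forms and their pullbacks *)

Section Homogeneous.
Variable K : numClosedFieldType.
Local Notation S := {mpoly K[2]}.
Local Notation V := 'cV[K]_2.
Implicit Types (p q f h F : S) (v w : V).

Definition hom d f := forall t v, t != 0 -> evalp f (t *: v) = t ^+ d * evalp f v.

Definition hcomp k f : S := pihomog mdeg k f.

Lemma dhomog_hom d f : f \is d.-homog -> hom d f.
Proof.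
move=> /dhomogP fd t v _; rewrite /evalp !mevalE mulr_sumr.
rewrite big_seq [RHS]big_seq; apply: eq_bigr => m /fd <-.
rewrite mulrCA; congr (_ * _).
under eq_bigr do rewrite mxE exprMn.
by rewrite big_split /= prodrXr mdegE.
Qed.

Lemma hom_hcomp k f : hom k (hcomp k f).
Proof. exact/dhomog_hom/pihomogP. Qed.

Lemma hcomp_sum f : f = \sum_(k < msize f) hcomp k f.
Proof. exact: pihomog_partitionE. Qed.

Lemma linep0 f v : linep f 0 v = \poly_(k < msize f) evalp (hcomp k f) v.
Proof.
apply: poly_fun_inj => t t0; rewrite horner_linep add0r horner_poly.
rewrite {1}(hcomp_sum f) evalp_sum; apply: eq_bigr => k _.
by rewrite hom_hcomp// mulrC.
Qed.

Lemma hcomp_geq f k : (msize f <= k)%N -> hcomp k f = 0.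
Proof.
move=> fk; rewrite /hcomp pihomogE big_seq_cond big_pred0// => m.
apply/negP => /andP[/msize_mdeg_lt + /eqP mk]; rewrite mk => kf.
by have := leq_trans kf fk; rewrite ltnn.
Qed.

Lemma coef_linep0 f v k : (linep f 0 v)`_k = evalp (hcomp k f) v.
Proof.
rewrite linep0 coef_poly; case: ltnP => // fk.
by rewrite hcomp_geq// evalp0.
Qed.

Lemma hom_linep0 d f v : hom d f -> linep f 0 v = evalp f v *: 'X^d.
Proof.
move=> fd; apply: poly_fun_inj => t t0.
by rewrite horner_linep add0r fd// hornerZ hornerXn mulrC.
Qed.

Lemma hom_hcompE d f : hom d f -> hcomp d f = f.
Proof.
move=> fd; apply: evalp_inj => v.
by rewrite -coef_linep0 (hom_linep0 v fd) coefZ coefXn eqxx mulr1.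
Qed.

Lemma hom_dhomog d f : hom d f -> f \is d.-homog.
Proof. by move=> /hom_hcompE <-; exact: pihomogP. Qed.

(** Two components never are both nonzero at a point, so their product is zero;
    polynomials form a domain, hence at most one component is nonzero. *)
Lemma monomial_hom f :
  (forall v, exists (c : K) m, linep f 0 v = c *: 'X^m) -> exists d, hom d f.
Proof.
move=> fm.
have prod0 k l : k != l -> hcomp k f * hcomp l f = 0.
  move=> kl; apply: evalp_eq0 => v; rewrite evalpM -!coef_linep0.
  have [c [m ->]] := fm v; rewrite !coefZ !coefXn.
  have [km|] := eqVneq k m; last by rewrite mulr0 mul0r.
  by rewrite -km eq_sym (negPf kl) !mulr0.
have [[k fk]|H] := pselect (exists k, hcomp k f != 0).
  exists k; have <- : hcomp k f = f; last exact: hom_hcomp.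
  rewrite [RHS]hcomp_sum.
  have [kf|] := ltnP k (msize f); last by move=> /hcomp_geq k0; rewrite k0 eqxx in fk.
  rewrite (bigD1 (Ordinal kf))//= big1 ?addr0// => l lk.
  have kl : k != l by apply: contraNneq lk => kl; apply/eqP/val_inj.
  have /eqP := prod0 _ _ kl.
  by rewrite mulf_eq0 (negPf fk) => /eqP.
exists 0%N => t v t0; rewrite (hcomp_sum f) big1 ?evalp0 ?mulr0// => k _.
by apply/eqP/negPn/negP => fk; apply: H; exists (val k).
Qed.

Lemma homXn d n f : hom d f -> hom (d * n) (f ^+ n).
Proof. by move=> fd t v t0; rewrite !evalpXn fd// exprMn exprM. Qed.

Lemma no_root_monomial (p : {poly K}) : (forall t, t != 0 -> p.[t] != 0) ->
  exists c m, p = c *: 'X^m.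
Proof.
move=> pn; have p0 : p != 0.
  by apply: contraTneq (pn 1 (oner_neq0 _)) => ->; rewrite horner0 eqxx.
have [m [q]] := multiplicity_XsubC p 0; rewrite p0 /= => qr pE.
have : size q == 1%N.
  apply/negPn/negP => /(closed_rootP q)[t qt].
  have t0 : t != 0 by apply: contraNneq qr => <-.
  have := pn t t0; rewrite pE hornerM.
  by rewrite (rootP qt) mul0r eqxx.
case/size_poly1P => c _ qc; exists c, m.
by rewrite pE qc subr0 mul_polyC.
Qed.

End Homogeneous.

Section InvariantComponents.
Variables (K : numClosedFieldType) (G : finite_subgroup_GL2 K).
Local Notation S := {mpoly K[2]}.
Local Notation V := 'cV[K]_2.
Implicit Types (p q f h F : S) (v w : V).

Lemma Ginvariant_hcomp k f : Ginvariant G f -> Ginvariant G (hcomp k f).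
Proof.
move=> fi g Gg v; rewrite -!coef_linep0; congr ((polyseq _)`_ _).
by apply: lineP => t _; rewrite !add0r scalemxAr fi.
Qed.

Lemma fibration_eq (x y : quotA2o G) v w :
  val x = quotient_pi (orbit_equiv G) v -> val y = quotient_pi (orbit_equiv G) w ->
  v != 0 -> w != 0 -> fibration x = fibration y ->
  exists g s, [/\ G g, s != 0 & w = s *: (g *m v)].
Proof.
move=> xv yw v0 w0.
rewrite (@fibrationE _ _ (mkA2o v0) _ xv) (@fibrationE _ _ (mkA2o w0) _ yw).
move/quotient_piP/asboolP => [g [v' [w' [Gg wv' /quotient_piP/asboolP[s s0 vs]
  /quotient_piP/asboolP[t t0 wt]]]]].
exists g, (t^-1 * s); split=> //; first by rewrite mulf_neq0// invr_eq0.
have vE : vec v' = s *: v by [].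
have wE : vec w' = t *: w by [].
by rewrite -scalerA scalemxAr -vE -wv' wE scalerA mulVf// scale1r.
Qed.

Variables (phi : morphism (quotA2 G) (quotA2 G)) (phio : morphism (quotA2o G) (quotA2o G)).
Variable beta : morphism (quotP1 G) (quotP1 G).
Hypotheses (phi_phio : restricts_to phi phio).
Hypothesis phi_beta : forall x, fibration (phio x) = beta (fibration x).
Local Notation pi v := (quotient_pi (orbit_equiv G) (v : V) : quotA2 G).
Local Notation zeta := (zeta phi).
Local Notation phis := (phis phi).

Lemma zeta_scale v t : v != 0 -> t != 0 ->
  exists g s, [/\ G g, s != 0 & zeta (t *: v) = s *: (g *m zeta v)].
Proof.
move=> v0 t0; have tv0 : t *: v != 0 by rewrite scaler_eq0 negb_or t0.
have yP (u : V) (u0 : u != 0) : (~` [set P0 G]) (pi u) by exact: pi_neq_P0.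
pose x : quotA2o G := SigSub (mem_set (yP _ v0)).
pose y : quotA2o G := SigSub (mem_set (yP _ tv0)).
have xE : val (phio x) = pi (zeta v) by rewrite phi_phio pi_zeta.
have yE : val (phio y) = pi (zeta (t *: v)) by rewrite phi_phio pi_zeta.
apply: (fibration_eq xE yE); [exact: (zeta_neq0 phi_phio)|exact: (zeta_neq0 phi_phio)|].
rewrite !phi_beta; congr (beta _).
rewrite (@fibrationE _ _ (mkA2o v0))// (@fibrationE _ _ (mkA2o tv0))//.
by congr (quotient_pi _ _); apply/quotient_piP/asboolP; exists t.
Qed.

Lemma phis_scale v t : v != 0 -> t != 0 ->
  exists2 s, s != 0 & forall d f, Ginvariant G f -> hom d f ->
  evalp (phis f) (t *: v) = s ^+ d * evalp (phis f) v.
Proof.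
move=> v0 t0; have [g [s [Gg s0 E]]] := zeta_scale v0 t0.
by exists s => // d f fi fd; rewrite !evalp_phis// E fd// fi.
Qed.

(** On a line through the origin [phis f] is [s ^+ d] times a constant, with
    [s != 0]: it vanishes identically or only at [0], so it is a monomial. *)
Lemma phis_hom d f : Ginvariant G f -> hom d f -> exists m, hom m (phis f).
Proof.
move=> fi fd; apply: monomial_hom => v.
have [->|v0] := eqVneq v 0.
  exists (evalp (phis f) 0), 0%N; apply: poly_fun_inj => t _.
  by rewrite horner_linep scaler0 addr0 hornerZ hornerXn mulr1.
have [fv|fv] := eqVneq (evalp (phis f) v) 0.
  exists 0, 0%N; rewrite scale0r; apply: poly_fun0 => t t0.
  rewrite horner_linep add0r; have [s _ E] := phis_scale v0 t0.
  by rewrite (E _ _ fi fd) fv mulr0.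
apply: no_root_monomial => t t0; rewrite horner_linep add0r.
have [s s0 E] := phis_scale v0 t0.
by rewrite (E _ _ fi fd) mulf_neq0// expf_neq0.
Qed.

(** Going from [v] to [2 *: v] multiplies both pullbacks by powers of one and the
    same factor [s], with exponents [d] and [e]. *)
Lemma phis_hom_ratio d e m n f h : Ginvariant G f -> Ginvariant G h -> hom d f -> hom e h ->
  phis f != 0 -> phis h != 0 -> hom m (phis f) -> hom n (phis h) ->
  (m * e = n * d)%N.
Proof.
move=> fi hi fd he f0 h0 fm hn.
have [v v0] := evalp_neq0 (mulf_neq0 f0 h0).
rewrite evalpM mulf_eq0 negb_or => /andP[fv hv].
have t0 : 2%:R != 0 :> K by rewrite pnatr_eq0.
have [s s0 E] := phis_scale v0 t0.
have /(mulIf fv) e1 := etrans (esym (fm _ v t0)) (E _ _ fi fd).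
have /(mulIf hv) e2 := etrans (esym (hn _ v t0)) (E _ _ hi he).
have : (2%:R ^+ (m * e) == 2%:R ^+ (n * d) :> K).
  by rewrite !exprM e1 e2 -!exprM mulnC.
by rewrite -!natrX eqr_nat eqn_exp2l// => /eqP.
Qed.

End InvariantComponents.

(** * Preservation of degrees *)

Section DegreeComparison.
Variable K : numClosedFieldType.
Local Notation S := {mpoly K[2]}.
Local Notation V := 'cV[K]_2.
Implicit Types (f h p q P Q : S) (v w : V).

(** The degree of a form [P] is visible on any line whose direction is not a
    zero of [P]: exchange the two homogeneous coordinates [1] and [t]. *)
Lemma size_linep_hom a P v0 v1 : hom a P -> evalp P v1 != 0 ->
  size (linep P v0 v1) = a.+1.
Proof.
move=> Pa P1; set p := linep P v0 v1; set q := linep P v1 v0.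
set M := size q.
pose r := \poly_(i < M.+1) q`_(M - i).
have sr : size r = M.+1.
  rewrite size_poly_eq//= subnn -horner_coef0 horner_linep scale0r addr0//.
have p0 : p != 0.
  apply/eqP => p0; have q0 t : t != 0 -> q.[t] = 0.
    move=> t0; rewrite horner_linep.
    have -> : v1 + t *: v0 = t *: (v0 + t^-1 *: v1).
      by rewrite scalerDr scalerA divff// scale1r addrC.
    by rewrite Pa// -horner_linep -/p p0 horner0 mulr0.
  have := P1; rewrite -[v1]addr0 -(scale0r v0) -horner_linep -/q.
  by rewrite (poly_fun0 q0) horner0 eqxx.
have E : 'X^M * p = 'X^a * r.
  apply: poly_fun_inj => t t0; rewrite !hornerM !hornerXn horner_poly horner_linep.
  have -> : v0 + t *: v1 = t *: (v1 + t^-1 *: v0).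
    by rewrite scalerDr scalerA divff// scale1r addrC.
  rewrite Pa// mulrCA; congr (_ * _).
  rewrite -horner_linep -/q (@horner_coef_wide _ M.+1 q)//.
  rewrite mulr_sumr [RHS](reindex_inj rev_ord_inj)/=; apply: eq_bigr => i _.
  have iM : (i <= M)%N by rewrite -ltnS.
  rewrite subSS subKn// exprVn mulrCA; congr (_ * _).
  by apply: (mulIf (expf_neq0 i t0)); rewrite -mulrA mulVf ?expf_neq0// mulr1 -exprD subnK.
have := congr1 (fun s : {poly K} => size s) E.
rewrite /= mulrC size_mulXn// mulrC size_mulXn; last by rewrite -size_poly_gt0 sr.
rewrite sr => sE; apply/eqP; rewrite -(eqn_add2l M) sE; apply/eqP.
by rewrite !addnS addnC.
Qed.

(** After division by the greatest common divisor a zero of one of the two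
    polynomials would be a zero of the other one. *)
Lemma size_eq_ratio (p q : {poly K}) : p != 0 -> q != 0 ->
  (forall u, exists p' q' : {poly K}, [/\ p'.[u] != 0, q'.[u] != 0 & p * q' = p' * q]) ->
  size p = size q.
Proof.
move=> p0 q0 H; set g := gcdp p q.
have g0 : g != 0 by rewrite gcdp_eq0 negb_and p0.
have pE : p = p %/ g * g by rewrite divpK// dvdp_gcdl.
have qE : q = q %/ g * g by rewrite divpK// dvdp_gcdr.
have cop : coprimep (p %/ g) (q %/ g) by rewrite coprimep_div_gcd// p0.
set p1 := p %/ g in pE cop; set q1 := q %/ g in qE cop.
have H1 u : exists a b, [/\ a != 0, b != 0 & p1.[u] * a = b * q1.[u]].
  have [p' [q' [p'u q'u E]]] := H u; exists q'.[u], p'.[u]; split=> //.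
  rewrite -!hornerM; congr (_.[_]); apply: (mulIf g0).
  by rewrite mulrAC -pE -mulrA -qE.
have noroot u : p1.[u] != 0 /\ q1.[u] != 0.
  have [a [b [a0 b0 E]]] := H1 u.
  have pq : (p1.[u] == 0) = (q1.[u] == 0).
    apply/eqP/eqP => z; move: E; rewrite z ?(mul0r, mulr0) => /eqP.
      by rewrite eq_sym mulf_eq0 (negPf b0) => /eqP.
    by rewrite mulf_eq0 (negPf a0) orbF => /eqP.
  rewrite -pq.
  have [pu|//] := boolP (p1.[u] == 0).
  by have := coprimep_root cop (x := u) pu; rewrite -pq pu.
have s1 (r : {poly K}) : (forall u, r.[u] != 0) -> size r = 1%N.
  move=> rn; apply/eqP/negPn/negP => /(closed_rootP r)[t] /rootP rt.
  by have := rn t; rewrite rt eqxx.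
rewrite pE qE !size_mul//; last 2 first.
- by apply: contraNneq q0 => q10; rewrite qE q10 mul0r.
- by apply: contraNneq p0 => p10; rewrite pE p10 mul0r.
by rewrite (s1 p1) ?(s1 q1)// => u; have [] := noroot u.
Qed.

(** The hypothesis says that the quotient of the two forms extends without zeros
    or poles to the punctured plane; restrict it to a line that avoids the
    origin and whose direction is not a zero of [P * Q]. *)
Lemma hom_degree_eq a b P Q : P != 0 -> Q != 0 -> hom a P -> hom b Q ->
  (forall v, v != 0 -> exists P' Q',
    [/\ evalp P' v != 0, evalp Q' v != 0 & P * Q' = P' * Q]) -> a = b.
Proof.
move=> P0 Q0 Pa Qb H; have [v1 v10] := evalp_neq0 (mulf_neq0 P0 Q0).
rewrite evalpM mulf_eq0 negb_or => /andP[P1 Q1].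
have [v0 v0P] : exists v0 : V, forall u, v0 + u *: v1 != 0.
  have [y0|y0] := eqVneq (v1 (lift ord0 ord0) ord0) 0.
    exists (delta_mx (lift ord0 ord0) ord0) => u; apply/eqP.
    move/colP/(_ (lift ord0 ord0))/eqP; rewrite !mxE y0 /= mulr0 addr0.
    by rewrite oner_eq0.
  exists (delta_mx ord0 ord0) => u; apply/eqP => E.
  have := congr1 (fun w : V => w (lift ord0 ord0) ord0) E.
  rewrite !mxE /= add0r => /eqP; rewrite mulf_eq0 (negPf y0) orbF => /eqP u0.
  have := congr1 (fun w : V => w ord0 ord0) E.
  by rewrite !mxE /= u0 mul0r addr0 => /eqP; rewrite oner_eq0.
have sP := size_linep_hom v0 Pa P1; have sQ := size_linep_hom v0 Qb Q1.
apply: succn_inj; rewrite -sP -sQ; apply: size_eq_ratio => [||u].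
- by rewrite -size_poly_gt0 sP.
- by rewrite -size_poly_gt0 sQ.
have [P' [Q' [P'v Q'v E]]] := H _ (v0P u).
exists (linep P' v0 v1), (linep Q' v0 v1); rewrite !horner_linep; split=> //.
by rewrite /linep -!rmorphM E.
Qed.

(** Differentiating the homogeneity identity lowers the degree by one for each
    factor of the Jacobian. *)
Lemma hom_jac d e f h : hom d f -> hom e h -> jac f h != 0 ->
  exists2 k, (k + 2 = d + e)%N & hom k (jac f h).
Proof.
move=> fd he J0.
have dE n p i t v : hom n p -> t != 0 -> t * evalp p^`M(i) (t *: v) = t ^+ n * evalp p^`M(i) v.
  move=> pn t0; rewrite -[RHS]evalpZ -mderivZ.
  have e1 q x : dder x (delta_mx i ord0) q = evalp q^`M(i) x.
    rewrite dderE (bigD1 i)//= mxE !eqxx mul1r big1 ?addr0// => j ji.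
    by rewrite mxE (negPf ji) mul0r.
  rewrite -[RHS]e1 (@dder_comp _ t%:M p).
    rewrite !mul_scalar_mx -e1 !dderE mulr_sumr; apply: eq_bigr => j _.
    by rewrite !mxE mulrA.
  by move=> x; rewrite evalpZ mul_scalar_mx pn.
have JE t v : t != 0 -> t ^+ 2 * evalp (jac f h) (t *: v) = t ^+ (d + e) * evalp (jac f h) v.
  move=> t0; rewrite /jac !evalpB !evalpM exprD expr2.
  transitivity (t * evalp f^`M(ord0) (t *: v) * (t * evalp h^`M(lift ord0 ord0) (t *: v))
   - t * evalp f^`M(lift ord0 ord0) (t *: v) * (t * evalp h^`M(ord0) (t *: v))).
    ring.
  rewrite !(dE d f)// !(dE e h)//; ring.
have [le2|gt2] := leqP 2 (d + e).
  exists (d + e - 2)%N; first by rewrite subnK.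
  move=> t v t0; apply: (mulfI (expf_neq0 2 t0)); rewrite JE// mulrA -exprD.
  by rewrite subnKC.
case/eqP: J0; apply: evalp_eq0 => v.
have k0 : (0 < 2 - (d + e))%N by rewrite subn_gt0.
have E : 'X^(2 - (d + e)) * linep (jac f h) 0 v = (evalp (jac f h) v)%:P.
  apply: poly_fun_inj => t t0; rewrite hornerM hornerXn horner_linep add0r hornerC.
  apply: (mulfI (expf_neq0 (d + e) t0)); rewrite mulrA -exprD subnKC; last exact: ltnW.
  exact: JE.
have := congr1 (horner^~ 0) E.
by rewrite hornerM hornerXn hornerC expr0n eqn0Ngt k0 mul0r.
Qed.

End DegreeComparison.

Lemma det_mx2 (R : comNzRingType) (A : 'M[R]_2) :
  \det A = A ord0 ord0 * A (lift ord0 ord0) (lift ord0 ord0)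
         - A ord0 (lift ord0 ord0) * A (lift ord0 ord0) ord0.
Proof.
rewrite (expand_det_row _ ord0) !big_ord_recl big_ord0 addr0 /cofactor !det_mx11 !mxE.
rewrite /= expr0 mul1r expr1 mulN1r mulrN.
by congr (_ * A _ _ - _ * A _ _); apply: val_inj.
Qed.

Section DegreePreserved.
Variables (K : numClosedFieldType) (G : finite_subgroup_GL2 K).
Local Notation S := {mpoly K[2]}.
Local Notation V := 'cV[K]_2.
Implicit Types (p q f h F : S) (v w : V).

Lemma det_exp_order g : G g -> \det g ^+ size (gelems G) = 1.
Proof.
move=> Gg; set D := \prod_(h <- gelems G) \det h.
have D0 : D != 0.
  rewrite /D prodf_seq_neq0; apply/allP => h /mem_gelems /gl2_unit.
  by rewrite unitmxE unitfE.
apply: (mulfI D0); rewrite mulr1.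
rewrite -[in RHS]/D {2}/D -(perm_big _ (gelems_mulr Gg)) big_map /=.
under eq_bigr do rewrite det_mulmx.
by rewrite big_split /= big_const_seq count_predT iter_mulr_1.
Qed.

Lemma jac_equivariant f h g v : Ginvariant G f -> Ginvariant G h -> G g ->
  evalp (jac f h) v = \det g * evalp (jac f h) (g *m v).
Proof.
move=> fi hi Gg.
have dE p i : Ginvariant G p -> evalp p^`M(i) v =
    g ord0 i * evalp p^`M(ord0) (g *m v)
    + g (lift ord0 ord0) i * evalp p^`M(lift ord0 ord0) (g *m v).
  move=> pi; have <- : dder v (delta_mx i ord0) p = evalp p^`M(i) v.
    rewrite dderE (bigD1 i)//= mxE !eqxx mul1r big1 ?addr0// => j ji.
    by rewrite mxE (negPf ji) mul0r.
  rewrite (@dder_comp _ g p) => [|x]; last by rewrite pi.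
  have ge j : (g *m delta_mx i ord0 : V) j ord0 = g j i.
    rewrite mxE (bigD1 i)//= mxE !eqxx mulr1 big1 ?addr0// => k ki.
    by rewrite mxE (negPf ki) mulr0.
  by rewrite dder2 !ge.
rewrite /jac !evalpB !evalpM !(dE f)// !(dE h)// det_mx2; ring.
Qed.

(** Invariance of the [N]-th power of the 2-form [dx /\ dy] under [G]. *)
Lemma Ginvariant_jac f h : Ginvariant G f -> Ginvariant G h -> Ginvariant G (jac f h ^+ size (gelems G)).
Proof.
move=> fi hi g Gg v; rewrite !evalpXn (jac_equivariant v fi hi Gg) exprMn.
by rewrite det_exp_order// mul1r.
Qed.

Lemma jac_hcomp f h : jac f h = \sum_(k < msize f) \sum_(l < msize h) jac (hcomp k f) (hcomp l h).
Proof.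
have dS p i : p^`M(i) = \sum_(k < msize p) (hcomp k p)^`M(i).
  by rewrite {1}(hcomp_sum p) raddf_sum.
rewrite /jac !(dS f) !(dS h) !mulr_suml -sumrB; apply: eq_bigr => k _.
by rewrite !mulr_sumr -sumrB.
Qed.

Lemma hom_jac_neq0 w : small G -> w != 0 -> exists d e f h,
  [/\ Ginvariant G f, Ginvariant G h, hom d f, hom e h & jac f h != 0].
Proof.
move=> Gs w0; have [f [h [fi hi J]]] := jac_neq0 Gs w0.
apply: contrapT => H.
have : jac f h = 0.
  rewrite jac_hcomp big1// => k _; rewrite big1// => l _.
  apply/eqP/negPn/negP => J0; apply: H; exists (val k), (val l), (hcomp k f), (hcomp l h).
  by split=> //; [exact: Ginvariant_hcomp|exact: Ginvariant_hcomp|exact: hom_hcomp|exact: hom_hcomp].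
by move=> J0; rewrite J0 evalp0 eqxx in J.
Qed.

Variables (phi : morphism (quotA2 G) (quotA2 G)).
Variables (phio phio' : morphism (quotA2o G) (quotA2o G)).
Variable beta : morphism (quotP1 G) (quotP1 G).
Hypotheses (phi_phio : restricts_to phi phio) (phio_etale : etale phio).
Hypothesis G_small : small G.
Hypothesis phi_phio' : restricts_to phi phio'.
Hypothesis phi_beta : forall x, fibration (phio' x) = beta (fibration x).
Local Notation zeta := (zeta phi).
Local Notation phis := (phis phi).

(** At each point the ratio of [P f h] to [Q f h] is a nonzero number that does
    not depend on [f] and [h], and for suitable invariants neither vanishes; so
    both have the same degree. Together with [phis_hom_ratio] this fixes the
    ratio of degrees. *)
Lemma phis_jac_degree f h d e m n : Ginvariant G f -> Ginvariant G h -> hom d f -> hom e h ->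
  hom m (phis f) -> hom n (phis h) -> jac f h != 0 -> m = d /\ (0 < d)%N.
Proof.
move=> fi hi fd he fm hn J0.
set N := size (gelems G).
have N0 : (0 < N)%N by exact: size_gelems_gt0.
pose Q f h := phis (jac f h ^+ N); pose P f h := jac (phis f) (phis h) ^+ N.
have PQ v : v != 0 -> exists2 c : K, c != 0 & forall f h, Ginvariant G f -> Ginvariant G h ->
    evalp (P f h) v = c * evalp (Q f h) v.
  move=> v0; have [c c0 cE] := jac_phis phi_phio phio_etale G_small v0.
  exists (c ^+ N); first exact: expf_neq0.
  move=> f1 h1 fi1 hi1; rewrite /P /Q evalp_phis; last exact: Ginvariant_jac.
  by rewrite !evalpXn cE// exprMn.
have phis_neq0 p : Ginvariant G p -> p != 0 -> phis p != 0.
  by move=> pi; apply: contraNneq => /(phis_inj phi_phio phio_etale G_small pi) ->.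
have JN0 : jac f h ^+ N != 0 by exact: expf_neq0.
have iJ : Ginvariant G (jac f h ^+ N) by exact: Ginvariant_jac.
have Q0 : Q f h != 0 by exact: phis_neq0.
have P0 : P f h != 0.
  have [v v0 Qv] := evalp_neq0 Q0; have [c c0 cE] := PQ v v0.
  by apply: contraNneq Qv => P0; have := cE f h fi hi;
    rewrite P0 evalp0 => /esym/eqP; rewrite mulf_eq0 (negPf c0).
have [k kE kh] := hom_jac fd he J0.
have Jp0 : jac (phis f) (phis h) != 0.
  by apply: contraNneq P0 => J; rewrite /P J expr0n eqn0Ngt N0.
have [k' k'E k'h] := hom_jac fm hn Jp0.
have Jk : hom (k * N) (jac f h ^+ N) by exact: homXn.
have [j jh] := phis_hom phi_phio' phi_beta iJ Jk.
have jE : (k' * N)%N = j.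
  apply: (hom_degree_eq P0 Q0 _ jh); first exact: homXn.
  move=> v v0; have [c c0 cE] := PQ v v0.
  have [f' [h' [fi' hi' J']]] := jac_neq0 G_small (zeta_neq0 phi_phio v0).
  exists (P f' h'), (Q f' h').
  have Q'v : evalp (Q f' h') v != 0.
    rewrite /Q evalp_phis; last exact: Ginvariant_jac.
    by rewrite evalpXn expf_neq0.
  split; [by rewrite (cE _ _ fi' hi') mulf_neq0|exact: Q'v|].
  apply/eqP; rewrite -subr_eq0; apply/negPn/negP => /evalp_neq0[y y0].
  have [b b0 bE] := PQ y y0.
  have cross (p q p' q' : S) : evalp p y = b * evalp q y ->
      evalp p' y = b * evalp q' y -> evalp (p * q' - p' * q) y = 0.
    by move=> pq pq'; rewrite evalpB !evalpM pq pq'; ring.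
  by rewrite (cross _ _ _ _ (bE _ _ fi hi) (bE _ _ fi' hi')) eqxx.
have f0 : f != 0.
  by apply: contraNneq J0 => ->; rewrite /jac !mderiv0 !mul0r subrr.
have h0 : h != 0.
  by apply: contraNneq J0 => ->; rewrite /jac !mderiv0 !mulr0 subrr.
have E1 := phis_hom_ratio phi_phio' phi_beta fi hi fd he (phis_neq0 _ fi f0)
  (phis_neq0 _ hi h0) fm hn.
have E2 := phis_hom_ratio phi_phio' phi_beta fi iJ fd Jk (phis_neq0 _ fi f0)
  (phis_neq0 _ iJ JN0) fm jh.
(* The ratio [m / d] is also that of the Jacobians, whose degrees are lower by
   [2] on both sides; this forces it to be [1]. *)
have E3 : (m * k = k' * d)%N.
  by apply/eqP; rewrite -(eqn_pmul2r N0) -mulnA E2 -jE mulnAC.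
have d0 : (0 < d)%N.
  rewrite lt0n; apply: contraNneq J0 => d0; rewrite /jac.
  have -> : f = (evalp f 0)%:MP.
    apply: evalp_inj => v; rewrite evalpC.
    have := congr1 (horner^~ 0) (hom_linep0 v fd).
    rewrite d0 expr0 hornerZ hornerC mulr1 horner_linep scale0r addr0 => ->//.
  by rewrite !mderivC !mul0r subrr.
split=> //.
have : (m * (k + 2) + 2 * d = (k' + 2) * d + 2 * m)%N.
  by rewrite !mulnDr mulnDl E3 [(m * 2)%N]mulnC addnAC.
rewrite kE k'E mulnDr mulnDl E1 -[(m * d + _ + _)%N]addnA -[(m * d + _ + _)%N]addnA.
by move/addnI/addnI/eqP; rewrite eqn_mul2l /= => /eqP.
Qed.

Lemma phis_degree f d : Ginvariant G f -> hom d f -> hom d (phis f).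
Proof.
move=> fi fd; have [->|f0] := eqVneq f 0.
  have -> : phis 0 = 0 by rewrite -(mpolyC0 2 K) phisC.
  by move=> t v _; rewrite !evalp0 mulr0.
have v0 : (const_mx 1 : V) != 0.
  by apply/eqP => /colP/(_ ord0)/eqP; rewrite !mxE oner_eq0.
have [d1 [e1 [f1 [h1 [fi1 hi1 fd1 he1 J]]]]] := hom_jac_neq0 G_small v0.
have [m1 fm1] := phis_hom phi_phio' phi_beta fi1 fd1.
have [n1 hn1] := phis_hom phi_phio' phi_beta hi1 he1.
have [m fm] := phis_hom phi_phio' phi_beta fi fd.
have [m1d d10] := phis_jac_degree fi1 hi1 fd1 he1 fm1 hn1 J.
have phis_neq0 p : Ginvariant G p -> p != 0 -> phis p != 0.
  by move=> pi; apply: contraNneq => /(phis_inj phi_phio phio_etale G_small pi) ->.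
have f10 : f1 != 0.
  by apply: contraNneq J => ->; rewrite /jac !mderiv0 !mul0r subrr.
have := phis_hom_ratio phi_phio' phi_beta fi fi1 fd fd1 (phis_neq0 _ fi f0)
  (phis_neq0 _ fi1 f10) fm fm1.
move/eqP; rewrite m1d mulnC eqn_pmul2l// => /eqP md.
by rewrite -md.
Qed.

End DegreePreserved.

(** * Characters of the ring of invariants *)

Section Nullstellensatz.
Variables (K : numClosedFieldType) (G : finite_subgroup_GL2 K).
Local Notation S := {mpoly K[2]}.
Local Notation V := 'cV[K]_2.
Implicit Types (p q f h F : S) (v w : V).

Variable chi : S -> K.
Hypothesis chiC : forall c, chi c%:MP = c.
Hypothesis chiD : forall f h, Ginvariant G f -> Ginvariant G h -> chi (f + h) = chi f + chi h.
Hypothesis chiM : forall f h, Ginvariant G f -> Ginvariant G h -> chi (f * h) = chi f * chi h.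

(** An ideal containing the kernel of [chi] on invariants; being defined through
    the trace it does not contain [1]. *)
Let J F := forall H, chi (Tr G (F * H)) = 0.

Let J_ker f : Ginvariant G f -> chi f = 0 -> J f.
Proof. by move=> fi f0 H; rewrite Tr_invM// chiM ?f0 ?mul0r//; exact: Ginvariant_Tr. Qed.

Let JM F H : J F -> J (F * H).
Proof. by move=> JF H'; rewrite -mulrA. Qed.

Let JD F H : J F -> J H -> J (F + H).
Proof.
move=> JF JH H'; rewrite mulrDl TrD chiD ?JF ?JH ?addr0//; exact: Ginvariant_Tr.
Qed.

Let J0 : J 0.
Proof. by rewrite -(mpolyC0 2 K); apply: J_ker; [exact: GinvariantC|rewrite chiC]. Qed.

Let J1 : ~ J 1.
Proof.
move=> /(_ 1); rewrite mulr1 Tr_inv; last exact: Ginvariant1.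
rewrite -mul_mpolyC mulr1 chiC => /eqP; exact/negP/size_gelems_neq0.
Qed.

Let eqn i : {poly K} := \poly_(k < (size (gelems G)).+1) chi (charp G 'X_i)`_k.

Let J_eqn i : J (map_poly (@mpolyC 2 K) (eqn i)).['X_i].
Proof.
have -> : (map_poly (@mpolyC 2 K) (eqn i)).['X_i] =
  \sum_(k < (size (gelems G)).+1)
     ((chi (charp G 'X_i)`_k)%:MP - (charp G 'X_i)`_k) * 'X_i ^+ k.
  under [RHS]eq_bigr do rewrite mulrBl.
  rewrite sumrB -(horner_coef_wide 'X_i) ?size_charp// charp_root subr0.
  rewrite (@horner_coef_wide _ (size (gelems G)).+1); last first.
    by apply: leq_trans (size_poly _ _) _; exact: size_poly.
  apply: eq_bigr => k _; rewrite coef_map /eqn coef_poly.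
  by rewrite ltn_ord.
apply: big_ind => // k _.
have ci := @Ginvariant_charp K G 'X_i k.
apply: JM; apply: J_ker; first by apply: GinvariantB => //; exact: GinvariantC.
rewrite -[X in _ - X]mul1r -mulNr -mpolyC1 -mpolyCN.
by rewrite chiD ?chiM ?chiC ?mulN1r ?subrr//; try apply: GinvariantM => //; exact: GinvariantC.
Qed.

(** Applying [chi] to the integral equations of the coordinates shows that the
    ideal [J] contains a product of linear factors in each coordinate. If at
    every point of the resulting finite grid some element of [J] did not vanish,
    the factors could be removed one by one until [1] is in [J]. *)
Lemma invariants_point : exists w, forall f, Ginvariant G f -> chi f = evalp f w.
Proof.
have split_eqn i : exists rs : seq K, J (\prod_(a <- rs) ('X_i - a%:MP)).
  have [rs rsE] := closed_field_poly_normal (eqn i); exists rs.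
  have lead1 : (eqn i)`_(size (gelems G)) = 1.
    rewrite /eqn coef_poly ltnSn.
    have : charp G 'X_i \is monic by exact: monic_prod_XsubC.
    rewrite monicE /lead_coef size_charp /= => /eqP ->.
    by rewrite -[1]mpolyC1 chiC.
  have e0 : lead_coef (eqn i) != 0.
    rewrite lead_coef_eq0; apply: contra_eq_neq lead1 => ->.
    by rewrite coef0 eq_sym oner_neq0.
  have := JM (lead_coef (eqn i))^-1%:MP (J_eqn i).
  rewrite {1}rsE map_polyZ hornerZ mulrC mulrA -mpolyCM mulVf//.
  rewrite mul1r rmorph_prod horner_prod; congr J; apply: eq_bigr => a _.
  by rewrite rmorphB /= map_polyX map_polyC hornerXsubC.
pose x : S := 'X_ord0; pose y : S := 'X_(lift ord0 ord0).
have [as_ Jas] := split_eqn ord0; have [bs Jbs] := split_eqn (lift ord0 ord0).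
apply: contrapT => H.
have sep (a b : K) : exists2 f, J f & exists2 k, k != 0 &
    exists A B, f = k%:MP + A * (x - a%:MP) + B * (y - b%:MP).
  pose w : V := \col_i (if i == ord0 then a else b).
  have [f [fi fw]] : exists f, Ginvariant G f /\ chi f <> evalp f w.
    apply: contrapT => H'; apply: H; exists w => f fi.
    by apply: contrapT => fw; apply: H'; exists f.
  have jf : J (f - (chi f)%:MP).
    apply: J_ker; first by apply: GinvariantB => //; exact: GinvariantC.
    by rewrite -mpolyCN chiD ?chiC ?subrr//; exact: GinvariantC.
  exists (f - (chi f)%:MP) => //; exists (evalp f w - chi f).
    by rewrite subr_eq0; apply/eqP/nesym.
  have [A [B fE]] : exists A B, f = (evalp f w)%:MP + A * (x - a%:MP) + B * (y - b%:MP).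
    have n01 : (0 : K) != 1 by rewrite eq_sym oner_neq0.
    have [A [B E]] := hadamard w f n01.
    exists (A + B), B; rewrite {1}E.
    rewrite /linform_at !evalp_linform /linform !mxE /= -!mul_mpolyC.
    by rewrite !mpolyC0 mpolyC1 !mpolyCD !mpolyCM !mpolyC0 mpolyC1 -/x -/y; ring.
  by exists A, B; rewrite {1}fE mpolyCB; ring.
have step_b (a : K) (bs' : seq K) U : J ((x - a%:MP) * U) ->
    J (\prod_(b <- bs') (y - b%:MP) * U) -> J U.
  elim: bs' U => [|b bs' IH] U Ja; first by rewrite big_nil mul1r.
  rewrite big_cons => Jb.
  have Jb' : J ((y - b%:MP) * U).
    apply: IH; first by rewrite mulrCA mulrC; exact: JM.
    by rewrite mulrCA mulrA.
  have [f Jf [k k0 [A [B fE]]]] := sep a b.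
  have -> : U = (k^-1)%:MP * (f * U - A * ((x - a%:MP) * U) - B * ((y - b%:MP) * U)).
    have kk : (k^-1)%:MP * k%:MP = 1 :> S by rewrite -mpolyCM mulVf.
    transitivity ((k^-1)%:MP * k%:MP * U); first by rewrite kk mul1r.
    by rewrite fE; ring.
  rewrite mulrC; apply: JM; apply: JD; first apply: JD.
  - exact: JM.
  - by rewrite -mulNr mulrC; exact: JM.
  - by rewrite -mulNr mulrC; exact: JM.
have step_a (as' : seq K) U : J (\prod_(a <- as') (x - a%:MP) * U) -> J U.
  elim: as' U => [|a as' IH] U; first by rewrite big_nil mul1r.
  rewrite big_cons => Ja; apply: (step_b a bs); last by exact: JM.
  by apply: IH; rewrite mulrCA mulrA.
by apply: J1; apply: (step_a as_); rewrite mulr1.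
Qed.

End Nullstellensatz.

(** * The inverse *)

Section Bijectivity.
Variables (K : numClosedFieldType) (G : finite_subgroup_GL2 K).
Variables (phi : morphism (quotA2 G) (quotA2 G)).
Variables (phio phio' : morphism (quotA2o G) (quotA2o G)).
Variable beta : morphism (quotP1 G) (quotP1 G).
Local Notation S := {mpoly K[2]}.
Local Notation V := 'cV[K]_2.
Local Notation pi v := (quotient_pi (orbit_equiv G) (v : V) : quotA2 G).
Local Notation zeta := (zeta phi).
Local Notation phis := (phis phi).
Implicit Types (p q f h F : S) (v w : V).

Definition reynolds F : S := (size (gelems G))%:R^-1 *: Tr G F.

Lemma Ginvariant_reynolds F : Ginvariant G (reynolds F).
Proof. by apply: GinvariantZ; exact: Ginvariant_Tr. Qed.

Lemma reynolds_id f : Ginvariant G f -> reynolds f = f.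
Proof.
by move=> fi; rewrite /reynolds Tr_inv// scalerA mulVf ?scale1r// size_gelems_neq0.
Qed.

Lemma reynolds_linear a F H : reynolds (a *: F + H) = a *: reynolds F + reynolds H.
Proof.
rewrite /reynolds; have -> : Tr G (a *: F + H) = a *: Tr G F + Tr G H.
  by rewrite TrD -!mul_mpolyC Tr_invM//; exact: GinvariantC.
by rewrite scalerDr !scalerA mulrC.
Qed.

(** The endomorphism of the invariants, extended by the identity of the kernel
    of the Reynolds operator to the space of all forms of a given degree, whose
    finite dimension then gives surjectivity. *)
Definition phis_ext F : S := phis (reynolds F) + (F - reynolds F).

Lemma phis_linear a f h : Ginvariant G f -> Ginvariant G h ->
  phis (a *: f + h) = a *: phis f + phis h.
Proof.
move=> fi hi; rewrite phisD//; last exact: GinvariantZ.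
by rewrite -!mul_mpolyC phisM// ?phisC//; exact: GinvariantC.
Qed.

Lemma phis_ext_linear a F H : phis_ext (a *: F + H) = a *: phis_ext F + phis_ext H.
Proof.
rewrite /phis_ext reynolds_linear phis_linear; [|exact: Ginvariant_reynolds..].
have regroup (P Q F1 H1 R1 R2 : S) : a *: P + Q + (a *: F1 + H1 - (a *: R1 + R2)) =
    a *: (P + (F1 - R1)) + (Q + (H1 - R2)) by rewrite -!mul_mpolyC; ring.
exact: regroup.
Qed.

Definition phis_dhomog d (F : dhomog 2 K d) : dhomog 2 K d :=
  DHomog (pihomogP mdeg d (phis_ext (mpoly_of_dhomog F))).

Lemma phis_dhomog_is_linear d : linear (@phis_dhomog d).
Proof.
move=> a F H; apply: val_inj => /=.
by rewrite phis_ext_linear linearP.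
Qed.

HB.instance Definition _ d := GRing.isLinear.Build K (dhomog 2 K d) (dhomog 2 K d)
  _ (@phis_dhomog d) (@phis_dhomog_is_linear d).

Hypotheses (phi_phio : restricts_to phi phio) (phio_etale : etale phio).
Hypothesis G_small : small G.
Hypothesis phi_phio' : restricts_to phi phio'.
Hypothesis phi_beta : forall x, fibration (phio' x) = beta (fibration x).

Let degree f d := phis_degree phi_phio phio_etale G_small phi_phio' phi_beta (f := f) (d := d).

Lemma hom_reynolds d F : hom d F -> hom d (reynolds F).
Proof.
move=> Fd t v t0; rewrite /reynolds !evalpZ !evalp_Tr mulrCA; congr (_ * _).
by rewrite mulr_sumr; apply: eq_bigr => g _; rewrite -scalemxAr Fd.
Qed.

Lemma phis_dhomogE d (F : dhomog 2 K d) :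
  mpoly_of_dhomog (phis_dhomog F) = phis_ext (mpoly_of_dhomog F).
Proof.
apply: pihomog_dE; apply: hom_dhomog.
have Fd : hom d (mpoly_of_dhomog F) by exact/dhomog_hom/(valP F).
have Rd := hom_reynolds Fd; have Pd := degree (@Ginvariant_reynolds _) Rd.
by move=> t v t0; rewrite /phis_ext !evalpD !evalpN Pd// Fd// Rd//; ring.
Qed.

Lemma reynolds_phis_ext F : reynolds (phis_ext F) = phis (reynolds F).
Proof.
have iR := @Ginvariant_reynolds F.
have -> : phis_ext F = 1 *: phis (reynolds F) + (-1 *: reynolds F + F).
  by rewrite /phis_ext scale1r scaleN1r [- _ + _]addrC.
rewrite !reynolds_linear (reynolds_id (Ginvariant_phis _ iR)) (reynolds_id iR).
by rewrite scale1r scaleN1r addNr addr0.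
Qed.

Lemma phis_surj_hom d f : Ginvariant G f -> hom d f -> exists2 h, Ginvariant G h & phis h = f.
Proof.
move=> fi fd; pose A := linfun (@phis_dhomog d).
have kerA : lker A == 0%VS.
  apply/lker0P => F H; rewrite !lfunE /= => E.
  apply/eqP; rewrite -subr_eq0; apply/eqP/val_inj.
  have /(congr1 (@mpoly_of_dhomog _ _ _)) : phis_dhomog (F - H) = 0.
    by rewrite linearB /= E subrr.
  rewrite phis_dhomogE => E0.
  have : phis (reynolds (mpoly_of_dhomog (F - H))) = 0.
    by rewrite -reynolds_phis_ext E0 /reynolds Tr_inv ?scaler0//; exact: Ginvariant0.
  move/(phis_inj phi_phio phio_etale G_small (@Ginvariant_reynolds _)) => R0.
  move: E0; rewrite /phis_ext R0 -(mpolyC0 2 K) phisC mpolyC0 add0r subr0.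
  by [].
pose fh : dhomog 2 K d := DHomog (hom_dhomog fd).
have /memv_imgP[F _ FE] : fh \in limg A by rewrite lker0_limgf// memvf.
exists (reynolds (mpoly_of_dhomog F)); first exact: Ginvariant_reynolds.
rewrite -reynolds_phis_ext -phis_dhomogE.
have <- : fh = phis_dhomog F by rewrite FE lfunE.
by rewrite reynolds_id.
Qed.

Lemma phis_surj f : Ginvariant G f -> exists2 h, Ginvariant G h & phis h = f.
Proof.
move=> fi; rewrite (hcomp_sum f).
elim/big_ind: _ => [|f1 f2 [h1 i1 <-] [h2 i2 <-]|k _].
- by exists 0; [exact: Ginvariant0|rewrite -(mpolyC0 2 K) phisC].
- by exists (h1 + h2); [exact: GinvariantD|rewrite phisD].
- by apply: (@phis_surj_hom k); [exact: Ginvariant_hcomp|exact: hom_hcomp].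
Qed.

Lemma phis_inj2 f h : Ginvariant G f -> Ginvariant G h -> phis f = phis h -> f = h.
Proof.
move=> fi hi E; apply/eqP; rewrite -subr_eq0; apply/eqP.
apply: (phis_inj phi_phio phio_etale G_small); first exact: GinvariantB.
have -> : f - h = -1 *: h + f by rewrite scaleN1r addrC.
by rewrite phis_linear// E scaleN1r addNr.
Qed.

Definition phis_inv f : S := xget 0 [set h | Ginvariant G h /\ phis h = f].

Lemma phis_invP f : Ginvariant G f -> Ginvariant G (phis_inv f) /\ phis (phis_inv f) = f.
Proof.
by move=> /phis_surj[h hi hE]; rewrite /phis_inv; case: xgetP => [h' _ //|/(_ h)[]].
Qed.

Lemma phis_invE f h : Ginvariant G h -> phis h = f -> phis_inv f = h.
Proof.
move=> hi <-; have [ii iE] := phis_invP (Ginvariant_phis phi hi).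
exact: phis_inj2.
Qed.

Lemma preimage_point v : exists w, forall f, Ginvariant G f -> evalp (phis_inv f) v = evalp f w.
Proof.
apply: (@invariants_point K G (fun f => evalp (phis_inv f) v)) => [c|f h fi hi|f h fi hi].
- by rewrite (@phis_invE _ c%:MP) ?phisC ?evalpC//; exact: GinvariantC.
- have [i1 e1] := phis_invP fi; have [i2 e2] := phis_invP hi.
  rewrite (@phis_invE _ (phis_inv f + phis_inv h)) ?evalpD ?phisD ?e1 ?e2//.
  exact: GinvariantD.
- have [i1 e1] := phis_invP fi; have [i2 e2] := phis_invP hi.
  rewrite (@phis_invE _ (phis_inv f * phis_inv h)) ?evalpM ?phisM ?e1 ?e2//.
  exact: GinvariantM.
Qed.

Definition inverse_point v : V := projT1 (cid (preimage_point v)).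

Lemma evalp_inverse_point f v : Ginvariant G f ->
  evalp f (inverse_point v) = evalp (phis_inv f) v.
Proof. by move=> fi; rewrite /inverse_point; case: cid => w /= ->. Qed.

Definition inverse_fun (x : quotA2 G) : quotA2 G := pi (inverse_point (lift_pt x)).

Lemma inverse_fun_pi f v w : Ginvariant G f -> inverse_fun (pi v) = pi w ->
  evalp f w = evalp (phis_inv f) v.
Proof.
move=> fi /(Ginvariant_pi fi) <-; rewrite evalp_inverse_point//.
by apply: Ginvariant_pi; [have [] := phis_invP fi|exact: pi_lift].
Qed.

Lemma inverse_fun_continuous : continuous inverse_fun.
Proof.
move=> x N; rewrite -(pi_lift x); set v := lift_pt x.
rewrite -[X in nbhs X N]pi_lift; set w := lift_pt (inverse_fun (pi v)).
have wv : inverse_fun (pi v) = pi w by exact: esym (pi_lift _).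
case/quot_nbhsP => r [ri rw rN]; apply/quot_nbhsP; exists (phis_inv r); split.
- by have [] := phis_invP ri.
- by rewrite -(inverse_fun_pi ri wv).
move=> y; rewrite -(@inverse_fun_pi r y (lift_pt (inverse_fun (pi y)))) ?pi_lift//.
by move=> /rN; rewrite pi_lift.
Qed.

Lemma inverse_fun_regular x g : regular_at (inverse_fun x) g ->
  regular_at x (g \o inverse_fun).
Proof.
rewrite -(pi_lift x); set v := lift_pt x.
rewrite -[X in regular_at X g]pi_lift; set w := lift_pt (inverse_fun (pi v)).
have wv : inverse_fun (pi v) = pi w by exact: esym (pi_lift _).
case/regular_quotP => p [q [ip iq qw qg]]; apply/regular_quotP.
have [ip' _] := phis_invP ip; have [iq' _] := phis_invP iq.
exists (phis_inv p), (phis_inv q); split=> //.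
  by rewrite -(inverse_fun_pi iq wv).
move=> y; set z := lift_pt (inverse_fun (pi y)).
have zy : inverse_fun (pi y) = pi z by exact: esym (pi_lift _).
by rewrite -(inverse_fun_pi ip zy) -(inverse_fun_pi iq zy) -qg /= zy.
Qed.

Lemma phis_bijective_automorphism : is_automorphism phi.
Proof.
exists (Morphism inverse_fun_continuous inverse_fun_regular); split=> x /=.
  rewrite -{2}(pi_lift x) -(pi_lift (inverse_fun _)); apply: invariants_separate => f fi.
  rewrite (@inverse_fun_pi f (zeta (lift_pt x)))//; last first.
    by rewrite pi_lift pi_zeta pi_lift.
  rewrite -[in LHS]evalp_phis; last by have [] := phis_invP fi.
  by have [_ ->] := phis_invP fi.
rewrite -{2}(pi_lift x) -(pi_lift (inverse_fun x)) -pi_zeta.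
apply: invariants_separate => f fi; rewrite -evalp_phis//.
have iP := Ginvariant_phis phi fi.
rewrite (@inverse_fun_pi (phis f) (lift_pt x)) ?pi_lift//.
by rewrite (phis_invE fi).
Qed.

End Bijectivity.

Theorem theorem2p4 (R : realType) (G : finite_subgroup_GL2 R[i])
    (G_nontrivial : exists2 g, G g & g <> 1%:M) (G_small : small G)
    (phi : morphism (quotA2 G) (quotA2 G))
    (phi_quasi_etale : quasi_etale phi)
    (phi_fibration : preserves_fibration phi) :
  is_automorphism phi.
Proof.
have [phio phi_phio phio_etale] := phi_quasi_etale.
have [phio' phi_phio' [beta phi_beta]] := phi_fibration.
exact: (@phis_bijective_automorphism R[i] G phi phio phio' beta).
Qed.
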